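(* For every integer $n\ge 1$ there is a unique threshold policy $\pi^*=(\tau_1^*,\tau_2^*,\ldots,\tau_n^* )\in\Pi(n)$ for which $$\beta(n)=\min_{\pi\in\Pi(n)}\mathbb{E}[\tau_n]=\mathbb{E}[\tau_n^*],$$ and for this optimal policy one has, for all $\alpha>2$, $$\operatorname{Var}[\tau_n^*]=\frac{1}{3}n^3+O(n^2\log^\alpha n)\quad\text{as } n\to\infty .$$
   Context: Let $X_1, X_2, \ldots$ be independent random variables, each uniformly distributed on $[0,1]$, and let $\mathcal{F}_i=\sigma\{X_1,\ldots,X_i\}$ for $i\ge 1$ ($\mathcal F_0$ trivial). For an integer $n\ge 1$, a selection policy is a sequence $\pi=(\tau_1,\ldots,\tau_n)$ of stopping times with respect to $(\mathcal{F}_i)$ such that, almost surely, $1\leq \tau_1<\tau_2<\cdots<\tau_n<\infty$ and $X_{\tau_1}<X_{\tau_2}<\cdots<X_{\tau_n}$. $\Pi(n)$ denotes the set of all selection policies with $\mathbb{E}[\tau_n]<\infty$, and $\beta(n)=\min_{\pi\in\Pi(n)}\mathbb{E}[\tau_n]$. Policies are identified when they agree almost surely. A threshold policy is a policy $\pi=(\tau_1,\ldots,\tau_n)\in\Pi(n)$ determined by a real sequence $\{t_i\in[0,1]:1\le i\le n\}$ through the recursion $$\tau_{k+1}=\min\{i>\tau_k: X_i\in[X_{\tau_k},\,X_{\tau_k}+t_{n-k}(1-X_{\tau_k})]\},\quad 0\le k<n,$$ started with $\tau_0=0$ and $X_0=0$. $\log^\alpha n$ means $(\log n)^\alpha$ with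 the natural logarithm. *)

(* Defs.v *)
From HB Require Import structures.
From mathcomp Require Import all_boot all_order all_algebra.
From mathcomp Require Import all_classical all_reals all_analysis.

Set Implicit Arguments.
Unset Strict Implicit.
Unset Printing Implicit Defensive.

Import Order.TTheory GRing.Theory Num.Theory.
Import numFieldNormedType.Exports.

Local Open Scope classical_set_scope.
Local Open Scope ring_scope.

(** Indexing: observations are numbered from 1, so the i-th observation
    (i >= 1) is the random variable [X i.-1]; [obs X i] is this i-th
    observation, with the convention that the 0-th one is 0.
    Stopping times take values in [option nat], [None] standing for +oo. *)

Definition obs {R : realType} {T : Type} (X : nat -> T -> R) (i : nat) (w : T)
  : R := if i is j.+1 then X j w else 0.

(** Mutual independence: the product rule over every finite subfamily. *)
Definition mutually_independent {d : measure_display} {T : measurableType d}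
    {R : realType} (P : probability T R) (X : nat -> T -> R) : Prop :=
  forall (J : seq nat) (B : nat -> set R), uniq J ->
    (forall j, measurable (B j)) ->
    (P (\bigcap_(j in [set` J]) X j @^-1` B j) =
     \prod_(j <- J) P (X j @^-1` B j))%E.

Definition uniform01 {d : measure_display} {T : measurableType d}
    {R : realType} (P : probability T R) (Y : {RV P >-> R}) : Prop :=
  forall B : set R, measurable B ->
    distribution P Y B = uniform_prob (@ltr01 R) B.

(** The sigma-algebra generated by the first [i] observations. *)
Definition nat_filtration {R : realType} {T : Type} (X : nat -> T -> R)
    (i : nat) : set (set T) :=
  g_sigma_preimage (fun j : 'I_i => X j : T -> measurableTypeR R).

Definition stopping_time {T : Type} (F : nat -> set (set T))
    (tau : T -> option nat) : Prop :=
  forall i : nat, F i [set w | exists2 m, tau w = Some m & (m <= i)%N].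

(** Real-valued version of a time. Times are integrated only when they are
    almost surely finite, so the value given at [None] is irrelevant. *)
Definition rtime {R : realType} {T : Type} (tau : T -> option nat) (w : T) : R :=
  (odflt 0%N (tau w))%:R.

Section Policies.
Context {d : measure_display} {T : measurableType d} {R : realType}.
Variables (P : probability T R) (X : nat -> T -> R).

(** A sequence (tau_1, ..., tau_n) is encoded by [tau : nat -> T -> option nat],
    of which only the values at 1 <= k <= n matter. *)
Definition selection_policy (n : nat) (tau : nat -> T -> option nat) : Prop :=
  (forall k, (1 <= k <= n)%N -> stopping_time (nat_filtration X) (tau k)) /\
  {ae P, forall w, exists s : nat -> nat,
    [/\ forall k, (1 <= k <= n)%N -> tau k w = Some (s k),
        (1 <= s 1)%N,
        forall k, (1 <= k < n)%N -> (s k < s k.+1)%N &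
        forall k, (1 <= k < n)%N -> obs X (s k) w < obs X (s k.+1) w]}.

(** The set Pi(n). *)
Definition policies (n : nat) : set (nat -> T -> option nat) :=
  [set tau | selection_policy n tau /\ ('E_P[rtime (tau n)] < +oo)%E].

Definition beta (n : nat) : \bar R :=
  ereal_inf [set 'E_P[rtime (tau n)]%E | tau in policies n].

(** min {i > m : q i}, equal to [None] (+oo) when there is no such [i]. *)
Definition first_after (q : pred nat) (m : nat) : option nat :=
  if pselect (exists i, (m < i)%N && q i) is left h then Some (ex_minn h)
  else None.

(** The recursion defining the k-th selection time from the thresholds
    [t 1], ..., [t n]. *)
Fixpoint threshold_time (n : nat) (t : nat -> R) (k : nat) (w : T)
    : option nat :=
  if k is k'.+1 then
    obind (fun m => first_after
             (fun i => obs X i w \in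
                `[obs X m w, obs X m w + t (n - k')%N * (1 - obs X m w)]) m)
          (threshold_time n t k' w)
  else Some 0%N.

Definition threshold_policy (n : nat) (tau : nat -> T -> option nat) : Prop :=
  policies n tau /\
  exists2 t : nat -> R,
    (forall i, (1 <= i <= n)%N -> 0 <= t i <= 1) &
    (forall k w, (1 <= k <= n)%N -> tau k w = threshold_time n t k w).

Definition optimal_threshold_policy (n : nat) (tau : nat -> T -> option nat)
    : Prop :=
  threshold_policy n tau /\ 'E_P[rtime (tau n)]%E = beta n.

Definition same_policy (n : nat) (tau tau' : nat -> T -> option nat) : Prop :=
  {ae P, forall w, forall k, (1 <= k <= n)%N -> tau k w = tau' k w}.

End Policies.

(* Main.v *)
Require Import Defs.
From HB Require Import structures.
From mathcomp Require Import all_boot all_order all_algebra.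
From mathcomp Require Import all_classical all_reals all_analysis.
From mathcomp Require Import measurable_realfun ring lra.

Set Implicit Arguments.
Unset Strict Implicit.
Unset Printing Implicit Defensive.

Import Order.TTheory GRing.Theory Num.Theory.
Import numFieldNormedType.Exports.

Local Open Scope classical_set_scope.
Local Open Scope ring_scope.

(** By scaling, when [k] selections remain and the last selected observation is
    [y], the best expected remaining time is [optv k / (1 - y)], where [optv k]
    is the best expected time for [k] selections. It is then right to select an
    observation [x >= y] when [optv k.-1 / (1 - x) <= optv k / (1 - y)], that is,
    when [x <= edge k y], which gives the threshold [optt k = 1 - optv k.-1 / optv k].
    Conditioning on the next observation gives the Bellman equation [optv_rec],
    [optv k.+1 - optv k = 1 + optv k * ln (optv k.+1 / optv k)], which has a unique
    solution since [z - 1 - ln z] increases from 0 to infinity on [1 <= z].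

    Optimality and uniqueness. A policy is described by its successive decisions
    and by the resulting state: the number of selections still to be made and the
    last selected observation. Since the next observation is uniform and
    independent of the past ([integral_freeze]), one step decreases the expected
    value of the state by at most the probability that the last selection is still
    to come. Summing over the steps yields [optv n <= E tau_n], provided that the
    contribution of the state at time [N] vanishes as [N] grows. To ensure this the
    value function is truncated at a constant: by [gain_trunc_le] the truncated
    function satisfies the same one-step inequality ([trunc_subsolution]), and the
    contribution is at most a constant times the probability that [tau_n > N]. If
    [E tau_n = optv n], all the one-step inequalities are equalities, so almost
    surely every decision is the one prescribed by the thresholds
    ([optimal_decisions]); the exception of an observation equal to [edge k y] has
    probability zero. Hence the optimal policy is unique among all policies, and
    in particular among threshold policies.

    Mean and variance. Under the thresholds [optt], the value of the state never
    increases ([opt_value_le]), so every function of the state below is bounded and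
    the one-step equations can be summed exactly. Let [p i] be the probability that
    the last selection comes after time [i]. Then [optv k / (1 - y)] gives the sums
    of the [p j] over [i <= j] ([value_step]), and [vsum k * optv k / (1 - y) ^+ 2]
    the sums of these sums ([value2_step]), with
    [vsum k = \sum_(j < k) optv j.+1 / (optv j.+1 - optv j)]. By [tail_sums] the mean
    is [optv n], the second moment is [2 * vsum n * optv n - optv n], and the variance
    is [optv n * (2 * vsum n - 1 - optv n)].

    Asymptotics. By the Bellman equation and elementary bounds on the logarithm,
    [sqrt (2 * optv n)] increases by [1 + O(1/n)] at each step, so that
    [optv n = n ^+ 2 / 2 + O(n ln n)]. At each step [2 * vsum n - optv n] increases
    by [2 * optv n / delta - delta], where [delta = optv n - optv n.-1]; both terms
    are close to [n], and their difference is [2 / 3 + O(1/n)] ([ratio_expansion]).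
    So [2 * vsum n - optv n = 2 n / 3 + O(ln n)], and the variance is
    [n ^+ 3 / 3 + O(n ^+ 2 * ln n)], which is within the stated error. *)

(** * Elementary bounds on the logarithm *)

Section LogBounds.
Context {R : realType}.
Implicit Types (x z u : R).

Lemma le_from_derivative (f f' : R -> R) (a x : R) :
  (forall y, a <= y -> is_derive y 1 f (f' y)) ->
  (forall y, a <= y -> 0 <= f' y) -> a <= x -> f a <= f x.
Proof.
move=> df f'0 ax.
apply: (@ger0_derive1_ndecr _ f a x) => //.
- by move=> y; rewrite in_itv/= => /andP[ay _]; have [] := df _ (ltW ay).
- move=> y; rewrite in_itv/= => /andP[ay _]; rewrite derive1E.
  by have [_ ->] := df _ (ltW ay); exact/f'0/ltW.
- apply: derivable_within_continuous => y; rewrite in_itv/= => /andP[ay _].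
  by have [] := df _ ay.
Qed.

Lemma is_derive_ln1D u : 0 <= u -> is_derive u 1 (fun v => ln (1 + v)) (1 + u)^-1.
Proof.
move=> u0; have := @is_derive1_comp R (@ln R) (fun v => 1 + v) u (1 + u)^-1 1.
rewrite mulr1; apply; first by apply: is_derive1_ln; lra.
by have := is_deriveD (is_derive_cst (1 : R) u 1) (is_derive_id u 1); rewrite add0r.
Qed.

Lemma ln1D_le u : 0 <= u -> ln (1 + u) <= u - u ^+ 2 / 2 + u ^+ 3 / 3.
Proof.
move=> u0.
pose f := fun v : R => v - v ^+ 2 / 2 + v ^+ 3 / 3 - ln (1 + v).
suff : f 0 <= f u by rewrite /f addr0 ln1; lra.
refine (@le_from_derivative f (fun v => v ^+ 3 / (1 + v)) 0 u _ _ u0) => y y0; last first.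
  by apply: divr_ge0; [exact: exprn_ge0|lra].
have dl := is_derive_ln1D y0.
rewrite /f; apply: is_derive_eq.
rewrite /GRing.scale/=; field; lra.
Qed.

Lemma ln1D_ge u : 0 <= u -> u - u ^+ 2 / 2 + u ^+ 3 / 3 - u ^+ 4 / 4 <= ln (1 + u).
Proof.
move=> u0.
pose f := fun v : R => ln (1 + v) - (v - v ^+ 2 / 2 + v ^+ 3 / 3 - v ^+ 4 / 4).
suff : f 0 <= f u by rewrite /f addr0 ln1; lra.
refine (@le_from_derivative f (fun v => v ^+ 4 / (1 + v)) 0 u _ _ u0) => y y0; last first.
  by apply: divr_ge0; [exact: exprn_ge0|lra].
have dl := is_derive_ln1D y0.
rewrite /f; apply: is_derive_eq.
rewrite /GRing.scale/=; field; lra.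
Qed.

Lemma ln_leB1 z : 0 < z -> ln z <= z - 1.
Proof. by move=> z0; have := @le_ln1Dx R (z - 1); rewrite (addrC 1) subrK; apply; lra. Qed.

Lemma ln_geBV z : 0 < z -> 1 - z^-1 <= ln z.
Proof.
move=> z0; have := @ln_leB1 z^-1; rewrite invr_gt0 => /(_ z0).
by rewrite lnV ?posrE//; lra.
Qed.

Lemma ln_le_half_diff z : 1 <= z -> 2 * ln z <= z - z^-1.
Proof.
move=> z1; have z0 : 0 < z by lra.
suff : 0 <= z ^+ 2 - 1 - 2 * (z * ln z).
  move=> h; rewrite -subr_ge0.
  have -> : z - z^-1 - 2 * ln z = (z ^+ 2 - 1 - 2 * (z * ln z)) / z by field; lra.
  by apply: divr_ge0 => //; lra.
pose f := fun v : R => v ^+ 2 - 1 - 2 * (v * ln v).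
suff : f 1 <= f z by rewrite /f ln1; lra.
refine (@le_from_derivative f (fun v => 2 * (v - 1 - ln v)) 1 z _ _ z1) => y y0.
  have dl : is_derive y 1 (@ln R) y^-1 by apply: is_derive1_ln; lra.
  rewrite /f; apply: is_derive_eq.
  rewrite /GRing.scale/=; field; lra.
have /ln_leB1 : 0 < y by lra.
lra.
Qed.

Lemma ln_ge_pade z : 1 <= z -> 2 * (z - 1) / (z + 1) <= ln z.
Proof.
move=> z1; rewrite ler_pdivrMr; last lra.
pose f := fun v : R => ln v * (v + 1) - 2 * (v - 1).
suff : f 1 <= f z by rewrite /f ln1; lra.
refine (@le_from_derivative f (fun v => ln v - (1 - v^-1)) 1 z _ _ z1) => y y0.
  have dl : is_derive y 1 (@ln R) y^-1 by apply: is_derive1_ln; lra.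
  rewrite /f; apply: is_derive_eq.
  rewrite /GRing.scale/=; field; lra.
have /ln_geBV : 0 < y by lra.
lra.
Qed.

Lemma ln3_ge1 : 1 <= ln (3 : R).
Proof.
have h3 : 1 <= (3 : R) by lra.
have := ln_ge_pade h3.
by have -> : 2 * (3 - 1) / (3 + 1) = 1 :> R by field; lra.
Qed.

Lemma ln_ratio_lt z : 1 < z -> ln z < z - 1.
Proof.
move=> z1; have := @ln_le_half_diff z (ltW z1).
have -> : z^-1 = 2 - z + (z - 1) ^+ 2 / z by field; lra.
have : 0 < (z - 1) ^+ 2 / z by apply: divr_gt0; [apply: exprn_gt0|]; lra.
lra.
Qed.

End LogBounds.

(** * The optimal values and thresholds *)

Section OptimalValues.
Context {R : realType}.
Implicit Types (b z : R).

Lemma value_ratio_exists b : 0 < b -> exists z, 1 < z /\ z - 1 - ln z = b^-1.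
Proof.
move=> b0; pose c := b^-1; have c0 : 0 < c by rewrite invr_gt0.
pose M := 2 + 2 * c.
have M1 : 1 <= M by rewrite /M; lra.
pose f := fun z : R => z - 1 - ln z.
have f1 : f 1 = 0 by rewrite /f ln1; lra.
have fM : c <= f M.
  have := ln_le_half_diff M1; rewrite /f.
  suff : 2 * c <= M - 2 + M^-1 by lra.
  have : 0 <= M^-1 by rewrite invr_ge0; lra.
  rewrite /M; lra.
have [] := @IVT R f 1 M c M1.
- apply: derivable_within_continuous => y; rewrite in_itv/= => /andP[y1 _].
  have dl : is_derive y 1 (@ln R) y^-1 by apply: is_derive1_ln; lra.
  have : is_derive y 1 f (1 - 0 - y^-1) by apply: is_deriveB.
  by case.
- have fM0 : 0 <= f M by exact: le_trans (ltW c0) fM.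
  by rewrite f1 min_l// max_r// fM ltW.
move=> z; rewrite in_itv/= => /andP[z1 _] fz; exists z; split => //.
rewrite lt_neqAle z1 andbT; apply/eqP => z1'.
by move: fz; rewrite -z1' f1 => c0'; rewrite -c0' ltxx in c0.
Qed.

(** The ratio of the optimal value following [b] to [b] itself: with [z] this
    ratio, the Bellman equation is [b * z - b = 1 + b * ln z]. *)
Definition value_ratio (b : R) : R := get [set z | 1 < z /\ z - 1 - ln z = b^-1].

Lemma value_ratioP b : 0 < b ->
  1 < value_ratio b /\ value_ratio b - 1 - ln (value_ratio b) = b^-1.
Proof.
move=> /value_ratio_exists [z hz].
have : [set z : R | 1 < z /\ z - 1 - ln z = b^-1] !=set0 by exists z.
exact: getPex.
Qed.

(** The least expected time needed for [n] selections. The first step is apart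
    because the ratio is not defined at 0: the first observation is selected. *)
Fixpoint optv (n : nat) : R :=
  match n with
  | 0 => 0
  | 1 => 1
  | k.+1 => optv k * value_ratio (optv k)
  end.

Lemma optv0 : optv 0 = 0. Proof. by []. Qed.

Lemma optv1 : optv 1 = 1. Proof. by []. Qed.

Arguments optv : simpl never.

Lemma optvS n : optv n.+2 = optv n.+1 * value_ratio (optv n.+1).
Proof. by []. Qed.

Lemma optv_ge1 n : 1 <= optv n.+1.
Proof.
elim: n => [//|n IHn]; rewrite optvS.
have b0 : 0 < optv n.+1 by lra.
by have [z1 _] := value_ratioP b0; apply: mulr_ege1 => //; exact: ltW.
Qed.

Lemma optv_gt0 n : 0 < optv n.+1.
Proof. by have := optv_ge1 n; lra. Qed.

Lemma optv_ge0 n : 0 <= optv n.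
Proof. by case: n => [//|n]; exact/ltW/optv_gt0. Qed.

Lemma optv_lt n : optv n < optv n.+1.
Proof.
case: n => [|n]; first by rewrite optv1 ltr01.
have [z1 _] := value_ratioP (optv_gt0 n).
by rewrite optvS ltr_pMr// optv_gt0.
Qed.

Lemma optv_ratio n : optv n.+2 / optv n.+1 = value_ratio (optv n.+1).
Proof. by rewrite optvS mulrAC divff ?mul1r// gt_eqF// optv_gt0. Qed.

(** The Bellman equation, in a form which holds from [n = 0] on. *)
Lemma optv_rec n :
  optv n.+1 - optv n = 1 + optv n * ln (optv n.+1 / optv n).
Proof.
case: n => [|n]; first by rewrite optv1 mul0r subr0 addr0.
have [z1 zE] := value_ratioP (optv_gt0 n).
rewrite optv_ratio optvS.
have b0 := optv_gt0 n.
have -> : ln (value_ratio (optv n.+1)) = value_ratio (optv n.+1) - 1 - (optv n.+1)^-1.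
  by rewrite -zE; ring.
by field; lra.
Qed.

(** The solution [t] of [optv k.-1 / (1 - t) = optv k]: at level 0, selecting
    [t] and waiting are equally good. *)
Definition optt (k : nat) : R := 1 - optv k.-1 / optv k.

Lemma optt_gt0 k : 0 < optt k.+1.
Proof. by rewrite /optt/= subr_gt0 ltr_pdivrMr ?mul1r ?optv_lt// optv_gt0. Qed.

Lemma optt_le1 k : optt k.+1 <= 1.
Proof. by rewrite /optt/= gerBl divr_ge0 ?optv_ge0. Qed.

Lemma optv_optt k : optv k.+1 * (1 - optt k.+1) = optv k.
Proof. by rewrite /optt/=; field; have := optv_gt0 k; lra. Qed.

(** If [m] and [m2] are the mean and the second moment of the optimal time for
    [n] selections, this is [(m2 + m) / (2 * m)]. It is the coefficient for which
    [value2] satisfies [value2_step]. *)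
Definition vsum (n : nat) : R := \sum_(k < n) optv k.+1 / (optv k.+1 - optv k).

End OptimalValues.

Arguments optv {R} n : simpl never.

(** * Asymptotics of the optimal values *)

Section Asymptotics.
Context {R : realType}.
Local Notation b := (@optv R).

(** The optimal values grow like [n ^+ 2 / 2]; in this scale, the Bellman
    equation is a nearly constant increment. *)
Definition sqv (n : nat) : R := Num.sqrt (2 * b n).

Lemma sqv_sq n : sqv n ^+ 2 = 2 * b n.
Proof. by rewrite sqr_sqrtr// mulr_ge0// optv_ge0. Qed.

Lemma sqv_ge1 n : 1 <= sqv n.+1.
Proof.
rewrite -(@sqrtr1 R) ler_wsqrtr//.
by have := @optv_ge1 R n; lra.
Qed.

Lemma sqv_lt n : sqv n < sqv n.+1.
Proof. by rewrite ltr_sqrt ?ltr_pM2l ?optv_lt// mulr_gt0// optv_gt0. Qed.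

(** With [r] the ratio of consecutive terms, the Bellman equation reads
    [r ^+ 2 - 1 - 2 * ln r = 2 / sqv n.+1 ^+ 2]. The lower bound comes from
    [2 * (z - 1) / (z + 1) <= ln z] at [z = r ^+ 2], and the upper bound from
    [2 * ln r <= r - 1 / r]. *)
Lemma sqv_step n :
  sqv n.+1 + 1 <= sqv n.+2 <= sqv n.+1 + 1 + (2 * sqv n.+1)^-1.
Proof.
have s1 := sqv_ge1 n; have ss := sqv_lt n.+1.
set s := sqv n.+1 in s1 ss *; set s' := sqv n.+2 in ss *.
have sE : s ^+ 2 = 2 * b n.+1 := sqv_sq n.+1.
have s'E : s' ^+ 2 = 2 * b n.+2 := sqv_sq n.+2.
have b0 := @optv_gt0 R n.
pose r := s' / s.
have r1 : 1 < r by rewrite ltr_pdivlMr ?mul1r//; lra.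
have rE : b n.+2 / b n.+1 = r ^+ 2.
  by rewrite /r expr_div_n sE s'E; field; lra.
have lnr : ln (r ^+ 2) = 2 * ln r by rewrite lnXn ?mulr_natl//; lra.
(* The Bellman equation, divided by the smaller of the two values. *)
have bell : r ^+ 2 - 1 - 2 * ln r = 2 / s ^+ 2.
  have := @optv_rec R n.+1; rewrite rE lnr.
  have -> : b n.+2 = b n.+1 * r ^+ 2 by rewrite -rE mulrC divfK// gt_eqF.
  rewrite sE => h.
  have bn0 : b n.+1 != 0 by rewrite gt_eqF.
  apply: (mulfI bn0).
  have -> : b n.+1 * (2 / (2 * b n.+1)) = 1 by field; lra.
  lra.
pose d := s' - s; have d0 : 0 < d by rewrite subr_gt0.
have rd : r = 1 + d / s by rewrite /r /d; field; lra.
(* Both bounds on [ln r] are turned into inequalities between [s] and [d]. *)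
have upper : d ^+ 2 * (2 * s + d) <= 2 * (s + d).
  have h : 2 / s ^+ 2 >= r ^+ 2 - 1 - (r - r^-1).
    by rewrite -bell; have := ln_le_half_diff (ltW r1); lra.
  have e : r ^+ 2 - 1 - (r - r^-1) = (2 / s ^+ 2) * (d ^+ 2 * (2 * s + d) / (2 * (s + d))).
    by rewrite rd; field; lra.
  move: h; rewrite e ger_pMr; last by rewrite divr_gt0// exprn_gt0//; lra.
  by rewrite ler_pdivrMr ?mul1r//; lra.
have lower : (2 * s + d) ^+ 2 * d ^+ 2 >= 2 * ((s + d) ^+ 2 + s ^+ 2).
  have h : 2 / s ^+ 2 <= r ^+ 2 - 1 - (2 * (r ^+ 2 - 1) / (r ^+ 2 + 1)).
    rewrite -bell lerD2l lerN2 -lnr; apply: ln_ge_pade.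
    by rewrite exprn_ege1// ltW.
  have e : r ^+ 2 - 1 - (2 * (r ^+ 2 - 1) / (r ^+ 2 + 1)) =
     (2 / s ^+ 2) * ((2 * s + d) ^+ 2 * d ^+ 2 / (2 * ((s + d) ^+ 2 + s ^+ 2))).
    rewrite rd; field; rewrite ?andbT; apply/andP; split; [|lra].
    by rewrite gt_eqF// addr_gt0// exprn_gt0//; lra.
  have q0 : 0 < 2 * ((s + d) ^+ 2 + s ^+ 2).
    by rewrite mulr_gt0// addr_gt0// exprn_gt0//; lra.
  move: h; rewrite e ler_pMr; last by rewrite divr_gt0// exprn_gt0//; lra.
  by rewrite ler_pdivlMr ?mul1r.
have d1 : 1 <= d.
  rewrite leNgt; apply/negP => d1.
  have : (2 * s + d) ^+ 2 * d ^+ 2 <= (2 * s + d) ^+ 2.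
    by rewrite ger_pMr ?exprn_ile1// ?exprn_gt0; lra.
  nra.
have d2 : d <= 1 + (2 * s)^-1.
  rewrite leNgt; apply/negP => d2.
  set q := (2 * s)^-1 in d2; have qs : q * (2 * s) = 1 by rewrite mulVf//; lra.
  have e1 : 1 < (d - 1) * (2 * s) by rewrite -[ltLHS]qs ltr_pM2r; lra.
  have e2 : d + 1 < (d - 1) * (2 * s) * (d + 1) by rewrite -[ltLHS]mul1r ltr_pM2r; lra.
  have e3 : 0 <= d * (d - 1) * (d + 1) by rewrite !mulr_ge0//; lra.
  lra.
rewrite /d in d1 d2; apply/andP; split; lra.
Qed.

(** The right-hand sides telescope: sums of terms [O(1/n)] are [O(ln n)]. *)
Lemma ln_natS n : (n.+2%:R)^-1 <= ln n.+2%:R - ln n.+1%:R :> R.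
Proof.
have n1 : 0 < n.+1%:R :> R by rewrite ltr0n.
have n2 : 0 < n.+2%:R :> R by rewrite ltr0n.
rewrite -ln_div ?posrE//.
apply: le_trans (ln_geBV _); last by rewrite divr_gt0.
by rewrite invf_div -[n.+2%:R]natr1; rewrite le_eqVlt; apply/orP; left; apply/eqP; field; lra.
Qed.

Lemma sqv_bounds n : n.+1%:R <= sqv n.+1 <= n.+1%:R + 1 + ln n.+1%:R.
Proof.
elim: n => [|n /andP[lo hi]].
  rewrite sqv_ge1 ln1 addr0/= -[leRHS]gtr0_norm; last lra.
  rewrite -sqrtr_sqr ler_sqrt ?optv1; [|apply: sqr_ge0].
  by rewrite /=; lra.
have /andP[st1 st2] := sqv_step n.
have n1 : 1 <= n.+1%:R :> R by rewrite ler1n.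
rewrite -!(natr1 n.+1) in st1 st2 *; apply/andP; split; first lra.
have := ln_natS n; rewrite -[n.+2%:R]natr1.
have : (2 * sqv n.+1)^-1 <= (n.+1%:R + 1)^-1 by rewrite lef_pV2 ?posrE; lra.
lra.
Qed.

Definition growth (n : nat) : R := b n.+2 / b n.+1 - 1.

Lemma growth_gt0 n : 0 < growth n.
Proof. by rewrite subr_gt0 ltr_pdivlMr ?mul1r ?optv_lt// optv_gt0. Qed.

Lemma growth_le n : growth n <= 12 * (ln n.+2%:R - ln n.+1%:R).
Proof.
have /andP[st1 st2] := sqv_step n.
have /andP[lo _] := sqv_bounds n.
have s1 := sqv_ge1 n.
apply: (@le_trans _ _ (6 / sqv n.+1)).
  rewrite /growth -(mulKf (_ : 2 != 0 :> R) (b n.+2)); last lra.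
  rewrite -(mulKf (_ : 2 != 0 :> R) (b n.+1)); last lra.
  rewrite -!sqv_sq.
  set s := sqv n.+1 in st1 st2 s1 *; set s' := sqv n.+2 in st1 st2 *.
  have V1 : (2 * s)^-1 <= 1 by rewrite invf_le1; lra.
  have -> : 2^-1 * s' ^+ 2 / (2^-1 * s ^+ 2) - 1 = (s' ^+ 2 - s ^+ 2) / s ^+ 2 by field; lra.
  rewrite ler_pdivrMr ?exprn_gt0//; last lra.
  have -> : 6 / s * s ^+ 2 = 6 * s by field; lra.
  have d2 : s' <= s + 1 + 2^-1.
    by apply: le_trans st2 _; rewrite lerD2l lef_pV2 ?posrE; lra.
  nra.
apply: (@le_trans _ _ (12 * (n.+2%:R)^-1)); last by rewrite ler_pM2l ?ln_natS.
have n1 : 1 <= n.+1%:R :> R by rewrite ler1n.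
rewrite ler_pdivrMr; last lra.
rewrite -[12 * _ * _]mulrA mulrC -mulrA ler_pdivlMl; last by rewrite ltr0n.
rewrite -(natr1 n.+1); lra.
Qed.

(** As [u] goes to 0, the first fraction is [2 / u + 2] and the second one is
    [2 / u + 4 / 3 + O(u)]. For [u <= 1] this follows from the Taylor bounds of
    the logarithm; for [1 < u] both fractions are bounded. *)
Lemma ratio_expansion (u : R) : 0 < u ->
  `|2 * (1 + u) / u - u / (u - ln (1 + u)) - 2 / 3| <= 4 * u.
Proof.
move=> u0.
have l0 : 0 < u - ln (1 + u) by have := @ln_ratio_lt R (1 + u); rewrite ltrDl u0 => /(_ isT); lra.
have l1 := ln1D_le (ltW u0); have l2 := ln1D_ge (ltW u0).
have lh : u ^+ 2 / (2 * (1 + u)) <= u - ln (1 + u).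
  have /ln_le_half_diff : 1 <= 1 + u by lra.
  have -> : u ^+ 2 / (2 * (1 + u)) = u - ((1 + u) - (1 + u)^-1) / 2 by field; lra.
  lra.
set l := u - ln (1 + u) in l0 lh *.
have {}l1 : u ^+ 2 / 2 - u ^+ 3 / 3 <= l by rewrite /l; lra.
have {}l2 : l <= u ^+ 2 / 2 - u ^+ 3 / 3 + u ^+ 4 / 4 by rewrite /l; lra.
have lu : u / l <= 2 * (1 + u) / u.
  rewrite ler_pdivrMr// mulrC mulrA ler_pdivlMr//.
  by move: lh; rewrite ler_pdivrMr; lra.
have ul0 : 0 < u / l by rewrite divr_gt0.
have -> : 2 * (1 + u) / u - u / l - 2 / 3 = 2 / u + 4 / 3 - u / l by field; lra.
have lu' : u / l <= 2 / u + 2.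
  by apply: le_trans lu _; rewrite le_eqVlt; apply/orP; left; apply/eqP; field; lra.
have [u1|u1] := leP u 1; last first.
  rewrite ler_norml; apply/andP; split; first by have : 0 < 2 / u by [rewrite divr_gt0]; lra.
  have : 2 / u <= 2 by rewrite ler_pdivrMr; lra.
  lra.
rewrite ler_norml; apply/andP; split.
  suff : u / l <= 2 / u + 4 / 3 + 4 * u by lra.
  rewrite ler_pdivrMr//.
  have e : u <= (2 / u + 4 / 3 + 4 * u) * (u ^+ 2 / 2 - u ^+ 3 / 3).
    have -> : (2 / u + 4 / 3 + 4 * u) * (u ^+ 2 / 2 - u ^+ 3 / 3) =
       u + u ^+ 3 * (14 / 9 - 4 / 3 * u) by field; lra.
    by rewrite lerDl mulr_ge0// ?exprn_ge0//; lra.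
  apply: le_trans e _; rewrite ler_pM2l//.
  by rewrite addr_gt0// ?mulr_gt0// addr_gt0// divr_gt0.
suff : 2 / u + 4 / 3 - 4 * u <= u / l by lra.
rewrite ler_pdivlMr//.
have [neg|pos] := leP (2 / u + 4 / 3 - 4 * u) 0.
  by apply: le_trans (ltW u0); rewrite mulr_le0_ge0// ltW.
apply: (@le_trans _ _ ((2 / u + 4 / 3 - 4 * u) * (u ^+ 2 / 2 - u ^+ 3 / 3 + u ^+ 4 / 4))).
  by rewrite ler_pM2l.
have -> : (2 / u + 4 / 3 - 4 * u) * (u ^+ 2 / 2 - u ^+ 3 / 3 + u ^+ 4 / 4) =
  u - u ^+ 3 * (35 / 18 - 5 / 3 * u + u ^+ 2) by field; lra.
rewrite gerBl mulr_ge0// ?exprn_ge0//; first lra.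
by have := sqr_ge0 u; lra.
Qed.

(** With [delta = b n.+2 - b n.+1] and [u = growth n], the step of
    [2 * vsum - b] from [n.+1] to [n.+2] is [2 * b n.+2 / delta - delta]. Here
    [b n.+2 / delta = (1 + u) / u] and, by the Bellman equation,
    [delta = u / (u - ln (1 + u))]. *)
Lemma vsum_asymptotics n :
  `|2 * vsum n.+1 - b n.+1 - 2 / 3 * n.+1%:R| <= 1 + 48 * ln n.+1%:R.
Proof.
elim: n => [|n IHn].
  rewrite /vsum big_ord_recl big_ord0 optv1 /optv/= subr0 ln1 mulr0 divr1 !addr0.
  by rewrite ler_norml; apply/andP; split; lra.
have u0 := growth_gt0 n; have ule := growth_le n; have b0 := @optv_gt0 R n.
have := ratio_expansion u0.
have vS : vsum n.+2 = vsum n.+1 + b n.+2 / (b n.+2 - b n.+1).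
  by rewrite /vsum big_ord_recr.
rewrite vS; rewrite -(natr1 n.+1) in ule *.
have uE : b n.+2 = b n.+1 * (1 + growth n).
  by rewrite /growth; field; lra.
have lE : growth n - ln (1 + growth n) = (b n.+1)^-1.
  have := @optv_rec R n.+1.
  have -> : b n.+2 / b n.+1 = 1 + growth n by rewrite /growth; ring.
  rewrite uE => h; have bn0 : b n.+1 != 0 by rewrite gt_eqF.
  apply: (mulfI bn0).
  by rewrite mulfV ?gt_eqF//; lra.
have -> : b n.+2 / (b n.+2 - b n.+1) = (1 + growth n) / growth n.
  have -> : b n.+2 - b n.+1 = b n.+1 * growth n by rewrite uE; ring.
  by rewrite uE -mulf_div divff ?mul1r// gt_eqF.
have -> : growth n / (growth n - ln (1 + growth n)) = b n.+2 - b n.+1.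
  by rewrite lE invrK uE; ring.
move: IHn; rewrite !ler_norml => /andP[h1 h2] /andP[h3 h4].
by apply/andP; split; lra.
Qed.

Lemma optv_asymptotics n (l := ln n.+3%:R : R) :
  [/\ 1 <= l, l <= n.+3%:R, 0 <= b n.+3 - n.+3%:R ^+ 2 / 2 &
      b n.+3 - n.+3%:R ^+ 2 / 2 <= 4 * n.+3%:R * l].
Proof.
have n3 : 3 <= n.+3%:R :> R by rewrite ler_nat.
have /andP[lo hi] := sqv_bounds n.+2.
have l1 : 1 <= l by apply: le_trans ln3_ge1 _; rewrite ler_ln ?posrE; lra.
have ln : l <= n.+3%:R by have := @ln_leB1 R n.+3%:R; rewrite /l ltr0n => /(_ isT); lra.
have bE := sqv_sq n.+3.
have {bE} -> : b n.+3 = sqv n.+3 ^+ 2 / 2 by rewrite bE; field.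
rewrite -/l in hi.
split => //; nra.
Qed.

(** See [variance_opt_time] for the first term. *)
Lemma variance_asymptotics n (l := ln n.+3%:R : R) :
  `|b n.+3 * (2 * vsum n.+3 - 1 - b n.+3) - 3^-1 * n.+3%:R ^+ 3|
    <= 300 * (n.+3%:R ^+ 2 * l).
Proof.
have [l1 ln b1 b2] := optv_asymptotics n; rewrite -/l in l1 ln b1 b2.
have hc := vsum_asymptotics n.+2; rewrite -/l in hc.
have n3 : 3 <= n.+3%:R :> R by rewrite ler_nat.
set m : R := n.+3%:R in n3 ln b1 b2 hc *.
have B0 : 0 <= b n.+3 by exact: optv_ge0.
set B := b n.+3 in b1 b2 hc B0 *.
set c := 2 * vsum n.+3 - B - 2 / 3 * m in hc.
have -> : B * (2 * vsum n.+3 - 1 - B) - 3^-1 * m ^+ 3 =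
   B * c + 2 / 3 * m * (B - m ^+ 2 / 2) - B by rewrite /c; field.
have Bm : B <= 5 * m ^+ 2 by nra.
have m2l : m ^+ 2 <= m ^+ 2 * l by rewrite ler_peMr// sqr_ge0.
have h1 : `|B * c| <= 5 * m ^+ 2 * (49 * l).
  by rewrite normrM ger0_norm// ler_pM//; apply: le_trans hc _; lra.
have h2 : `|2 / 3 * m * (B - m ^+ 2 / 2)| <= 3 * (m ^+ 2 * l).
  rewrite ger0_norm; last by rewrite mulr_ge0// mulr_ge0; lra.
  have -> : 3 * (m ^+ 2 * l) = 2 / 3 * m * (4 * m * l) + (1 / 3) * (m ^+ 2 * l) by field.
  have : 2 / 3 * m * (B - m ^+ 2 / 2) <= 2 / 3 * m * (4 * m * l).
    by rewrite ler_pM2l//; lra.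
  have : 0 <= m ^+ 2 * l by rewrite mulr_ge0 ?sqr_ge0//; lra.
  lra.
apply: le_trans (ler_normB _ _) _.
apply: le_trans (lerD (ler_normD _ _) (lexx _)) _.
rewrite (ger0_norm B0); lra.
Qed.

End Asymptotics.

(** * Independence of the next observation from the past *)

Lemma nat_filtrationE {R : realType} {T : Type} (X : nat -> T -> R) i :
  nat_filtration X i = <<s \big[setU/set0]_(j < i)
    preimage_set_system setT (X j : T -> measurableTypeR R) measurable >>.
Proof. by []. Qed.

(* The filtration is used only through the closure properties below. *)
#[local] Opaque nat_filtration.

Section Freezing.
Context {R : realType} {d : measure_display} {T : measurableType d}.
Variables (P : probability T R) (X : nat -> {RV P >-> R}).
Hypothesis X_indep : mutually_independent P (fun i => X i).

Local Notation F := (nat_filtration (fun i => X i : T -> R)).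

Lemma filtrationX i j (B : set R) : (j < i)%N -> measurable B -> F i (X j @^-1` B).
Proof.
move=> ji mB; rewrite nat_filtrationE; apply: sub_gen_smallest.
apply: (@bigsetU_sup _ j i (fun j => preimage_set_system setT (X j : T -> R) measurable) ji).
by exists B => //; rewrite setTI.
Qed.

Lemma filtration_min i (G : set (set T)) : sigma_algebra setT G ->
  (forall j B, (j < i)%N -> measurable B -> G (X j @^-1` B)) -> F i `<=` G.
Proof.
move=> sG GX; rewrite nat_filtrationE; apply: smallest_sub => //.
apply: (big_ind (fun H => H `<=` G)) => //.
  by move=> H K HG KG A [/HG|/KG].
by move=> j _ _ [B mB <-]; rewrite setTI; exact: GX.
Qed.

Lemma filtration_salgebra i : sigma_algebra setT (F i).
Proof. by rewrite nat_filtrationE; exact: smallest_sigma_algebra. Qed.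

Lemma filtration0 i : F i set0.
Proof. by have [] := @filtration_salgebra i. Qed.

Lemma filtrationC i A : F i A -> F i (~` A).
Proof. have [_ h _] := @filtration_salgebra i; rewrite -setTD; exact: h. Qed.

Lemma filtrationT i : F i setT.
Proof. by have := filtrationC (@filtration0 i); rewrite setC0. Qed.

Lemma filtrationU i A B : F i A -> F i B -> F i (A `|` B).
Proof.
move=> FA FB; rewrite -bigcup2E; have [_ _ h] := @filtration_salgebra i.
apply: h => n; rewrite /bigcup2; do 2 case: ifP => // _; exact: filtration0.
Qed.

Lemma filtrationI i A B : F i A -> F i B -> F i (A `&` B).
Proof.
have -> : A `&` B = ~` (~` A `|` ~` B) by rewrite setCU !setCK.
by move=> FA FB; apply: filtrationC; apply: filtrationU; exact: filtrationC.
Qed.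

Lemma filtration_le i j : (i <= j)%N -> F i `<=` F j.
Proof.
move=> ij; apply: filtration_min; first exact: filtration_salgebra.
by move=> k B ki mB; apply: filtrationX => //; exact: leq_trans ij.
Qed.

Lemma filtration_measurable i A : F i A -> measurable A.
Proof.
apply: filtration_min; first exact: sigma_algebra_measurable.
by move=> j B _ mB; exact: measurable_funPTI.
Qed.

(** Both sides are finite measures of [A]. They agree on the intersections of
    events [X j \in C j], [j < i], by the product rule for finite subfamilies,
    and these intersections are stable under intersection and generate the
    past. *)
Lemma past_next_independent i A (B : set R) : F i A -> measurable B ->
  P (A `&` X i @^-1` B) = (P A * P (X i @^-1` B))%E.
Proof.
move=> FA mB; set D := X i @^-1` B.
have mD : measurable D by exact: measurable_funPTI.
pose G : set (set T) := [set A | exists2 C : nat -> set R,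
  (forall j, measurable (C j)) &
  A = \bigcap_(j in [set` iota 0 i]) X j @^-1` C j].
have Gm : G `<=` measurable.
  move=> _ [C mC ->]; apply: bigcap_measurableType => //.
  by move=> j _; exact: measurable_funPTI.
have GT : G setT.
  by exists (fun=> setT) => //; apply/esym; rewrite -subTset => w _ j _.
have GI : setI_closed G.
  move=> _ _ [C mC ->] [C' mC' ->]; exists (fun j => C j `&` C' j).
    by move=> j; exact: measurableI.
  apply/seteqP; split => w /=.
    by move=> [CX C'X] j ji; split; [exact: CX|exact: C'X].
  by move=> CX; split => j ji; have [] := CX j ji.
have pD : 0 <= fine (P D) by rewrite fine_ge0.
pose p := NngNum pD.
have -> : (P (A `&` D) = mrestr P mD A)%E by [].
have pE B' : mscale p P B' = (P B' * P D)%E.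
  by rewrite /mscale/= fineK ?fin_num_measure// muleC.
rewrite -pE.
apply: (@g_sigma_algebra_measure_unique _ _ _ G Gm (fun=> setT)) => //.
- by rewrite -subTset => w _; exists 0%N.
- move=> _ [C mC ->]; rewrite [RHS]pE muleC.
  pose C' j := if j == i then B else C j.
  have mC' j : measurable (C' j) by rewrite /C'; case: ifP.
  have iota_neq j : j \in iota 0 i -> (j == i) = false.
    by rewrite mem_iota add0n => /andP[_ ji]; rewrite ltn_eqF.
  rewrite (X_indep (iota_uniq 0 i) mC).
  have -> : (P D * \prod_(j <- iota 0 i) P (X j @^-1` C j) =
    \prod_(j <- i :: iota 0 i) P (X j @^-1` C' j))%E.
    rewrite big_cons {1}/C' eqxx; congr (_ * _)%E.
    by apply: eq_big_seq => j ji; rewrite /C' iota_neq.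
  rewrite -(@X_indep (i :: iota 0 i) C')//; last first.
    by rewrite /= iota_uniq andbT mem_iota add0n ltnn andbF.
  rewrite -[LHS]/(P (_ `&` D)) setIC; congr (P _); apply/seteqP; split => w /=.
    move=> [Dw Cw] j /=; rewrite inE => /predU1P[->|ji]; first by rewrite /C' eqxx.
    by rewrite /C' iota_neq//; exact: Cw.
  move=> Cw; split; first by have := Cw i; rewrite /= inE eqxx /C' eqxx; exact.
  move=> j /= ji; have := Cw j; rewrite /= inE ji orbT /C' iota_neq//; exact.
- move=> _; rewrite -[ltLHS]/(P (setT `&` D)) setTI.
  exact: le_lt_trans (probability_le1 P mD) (ltry 1%R).
- apply: (filtration_min _ _ FA); first exact: smallest_sigma_algebra.
  move=> j C ji mC; apply: sub_gen_smallest.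
  exists (fun k => if k == j then C else setT).
    by move=> k; case: ifP.
  apply/seteqP; split => w.
    by move=> Xw k _ /=; case: eqP => // ->.
  by move=> /(_ j)/=; rewrite eqxx; apply; rewrite mem_iota.
Qed.

Hypothesis X_unif : forall i, uniform01 (X i).

Local Notation mu := (@lebesgue_measure R).

Lemma integral_obs i (f : R -> \bar R) : measurable_fun setT f ->
  (forall x, 0 <= f x)%E ->
  (\int[P]_w f (X i w) = \int[mu]_(x in `[0%R, 1%R]) f x)%E.
Proof.
move=> mf f0.
have mX : measurable_fun setT (X i : T -> measurableTypeR R).
  exact: (@measurable_funPT _ _ _ _ (X i)).
pose mX_mixin := isMeasurableFun.Build _ _ _ _ _ mX.
pose X' : {mfun T >-> measurableTypeR R} := HB.pack (X i : T -> R) mX_mixin.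
transitivity (\int[distribution P X']_x f x)%E.
  by rewrite (@ge0_integral_distribution _ _ _ _ _ P X' f).
transitivity (\int[uniform_prob (@ltr01 R)]_x f x)%E.
  by apply: eq_measure_integral => A mA _; exact: X_unif.
by rewrite integral_uniform// subr0 invr1 mul1e.
Qed.

(** The joint law of [Z] and [X i] is the product of their laws, so the
    integral can be computed with the past frozen (Tonelli). *)
Lemma integral_freeze i {d'} {E : measurableType d'} (Z : T -> E)
    (g : E -> R -> \bar R) :
  (forall B, measurable B -> F i (Z @^-1` B)) ->
  measurable_fun setT (fun p : E * R => g p.1 p.2) ->
  (forall z x, 0 <= g z x)%E ->
  (\int[P]_w g (Z w) (X i w) =
   \int[P]_w \int[mu]_(x in `[0%R, 1%R]) g (Z w) x)%E.
Proof.
move=> FZ mg g0.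
have mZ : measurable_fun setT Z.
  by move=> _ B mB; rewrite setTI; apply: (@filtration_measurable i); exact: FZ.
pose mZ_mixin := isMeasurableFun.Build _ _ _ _ _ mZ.
pose Z' : {mfun T >-> E} := HB.pack Z mZ_mixin.
have mW : measurable_fun setT (fun w => (Z' w, X i w)).
  by apply/measurable_fun_pair.
pose mW_mixin := isMeasurableFun.Build _ _ _ _ _ mW.
pose W : {mfun T >-> (E * R)%type} := HB.pack (fun w => (Z' w, X i w)) mW_mixin.
pose G := fun p : E * R => g p.1 p.2.
have G0 p : (0 <= G p)%E by exact: g0.
transitivity (\int[distribution P W]_p G p)%E.
  by rewrite (@ge0_integral_distribution _ _ _ _ _ P W G).
transitivity (\int[distribution P Z' \x distribution P (X i)]_p G p)%E.
  apply: eq_measure_integral => A mA _; apply/esym.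
  apply: product_measure_unique => // B C mB mC.
  by have := past_next_independent (FZ _ mB) mC.
rewrite fubini_tonelli1//.
rewrite (@ge0_integral_distribution _ _ _ _ _ P Z')//.
- apply: eq_integral => w _ /=; rewrite /fubini_F/=.
  have mgz : measurable_fun setT (g (Z w)) by exact: (measurable_fun_pair2 _ mg).
  rewrite (@ge0_integral_distribution _ _ _ _ _ P (X i) (g (Z w)))//.
  exact: (integral_obs i mgz (g0 _)).
- exact: measurable_fun_fubini_tonelli_F.
- by move=> z; apply: integral_ge0.
Qed.

End Freezing.

(** * Trajectories *)

Section Trajectories.
Local Open Scope nat_scope.
Implicit Types (D : nat -> bool) (q : nat -> nat -> pred nat) (t : nat -> option nat).

(** [D j] is the decision about the observation made at time [j.+1]. The state at
    time [i] is the number of selections made so far and the time of the last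
    one, or 0. *)
Fixpoint run D (i : nat) : nat * nat :=
  if i is j.+1 then
    let s := run D j in if D j then (s.1.+1, j.+1) else s
  else (0, 0).

Definition hits (n : nat) t (i : nat) : bool :=
  [exists k : 'I_n, t k.+1 == Some i.+1].

Lemma run_last_le D i : (run D i).2 <= i.
Proof. by elim: i => [//|i IHi] /=; case: ifP => // _; exact: leqW. Qed.

(** The state at time [i] determines which selection times are at most [i]. At
    a selection made at time [i.+1], monotonicity forces the index [k] with
    [s k = i.+1] to be the successor of the number of earlier selections. *)
Lemma run_hits n t (s : nat -> nat) :
  (forall k, 1 <= k <= n -> t k = Some (s k)) -> 1 <= s 1 ->
  (forall k, 1 <= k < n -> s k < s k.+1) ->
  forall i, [/\ (run (hits n t) i).1 <= n,
    forall k, 1 <= k <= n -> (s k <= i) = (k <= (run (hits n t) i).1) &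
    (run (hits n t) i).2 =
      if (run (hits n t) i).1 is c.+1 then s c.+1 else 0].
Proof.
move=> ts s1 sS.
have smono k l : 1 <= k -> k < l -> l <= n -> s k < s l.
  move=> k1; elim: l => // l IHl; rewrite ltnS leq_eqVlt => /predU1P[<-|kl] ln.
    by apply: sS; rewrite k1.
  apply: ltn_trans (IHl kl (ltnW ln)) _.
  by apply: sS; rewrite ln andbT (leq_trans _ kl).
elim=> [|i [cn sc lc]] /=.
  split => // k /andP[k1 kn]; rewrite leqn0 [RHS]leqNgt k1/=; apply/negbTE.
  rewrite -lt0n; move: k1; rewrite leq_eqVlt => /predU1P[<-//|k1].
  by apply: (leq_trans s1); rewrite ltnW// smono.
set c := (run _ i).1 in cn sc lc *.
case: ifPn => [/existsP[[k' k'n] /eqP] /= | /existsPn noD].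
  have kn : 1 <= k'.+1 <= n by rewrite k'n.
  rewrite (ts _ kn) => -[sk].
  have ck : c < k'.+1 by rewrite ltnNge -(sc _ kn) sk ltnn.
  have kc : k'.+1 = c.+1.
    apply/eqP; rewrite eqn_leq ck andbT leqNgt; apply/negP => ck'.
    have cn' : c.+1 <= n by apply: (leq_trans _ k'n); exact: ltnW.
    have := smono c.+1 k'.+1 isT ck' k'n.
    by rewrite sk ltnS (sc c.+1)// ltnn.
  rewrite kc in sk kn.
  split; [by case/andP: kn| |by rewrite sk] => l /andP[l1 ln].
  have [lc'|cl] := leqP l c.
    by rewrite (leqW lc'); apply/leqW; rewrite sc// l1 ln.
  move: cl; rewrite leq_eqVlt => /predU1P[<-|cl]; first by rewrite sk !leqnn.
  rewrite [RHS]leqNgt cl; apply/negbTE; rewrite -ltnNge -sk smono//.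
split => // k /andP[k1 kn]; rewrite leq_eqVlt -sc ?k1//.
suff -> : (s k == i.+1) = false by rewrite ltnS.
apply/negP => /eqP sk.
have k'n : k.-1 < n by rewrite prednK.
by have := noD (Ordinal k'n); rewrite /= prednK// ts ?k1// sk eqxx.
Qed.

Lemma first_afterP (p : pred nat) m j :
  first_after p m = Some j <->
  [/\ m < j, p j & forall i, m < i < j -> ~~ p i].
Proof.
rewrite /first_after; case: pselect => [h|nh]; last first.
  by split => // -[mj pj _]; case: nh; exists j; rewrite mj.
case: ex_minnP => k /andP[mk pk] kmin; split => [[<-]|[mj pj jmin]].
  split => // i /andP[mi ik]; apply/negP => pi.
  by have := kmin i; rewrite mi pi => /(_ isT); rewrite leqNgt ik.
congr Some; apply/eqP; rewrite eqn_leq kmin ?mj//= leqNgt; apply/negP => kj.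
by have := jmin k; rewrite mk kj pk => /(_ isT).
Qed.

(** Here [q k m i] tells whether the observation made at time [i] is accepted
    after [k] selections, the last of which was made at time [m]. *)
Fixpoint seltime q (k : nat) : option nat :=
  if k is k'.+1 then obind (fun m => first_after (q k' m) m) (seltime q k')
  else Some 0.

Lemma seltimeS q k j : seltime q k.+1 = Some j ->
  exists m, [/\ seltime q k = Some m, m < j & q k m j].
Proof.
rewrite /=; case: (seltime q k) => //= m /first_afterP[mj qj _].
by exists m.
Qed.

(** The recursion on time (of the state [run D]) and the recursion on the
    number of selections (of [seltime q]) describe the same trajectory. The
    invariant says in addition that [q] has refused all the observations since
    the last selection. *)
Lemma seltime_run n q D :
  (forall i, D i = ((run D i).1 < n) && q (run D i).1 (run D i).2 i.+1) ->
  forall i, (run D i).1 <= n /\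
    forall k, k <= n ->
      k <= (run D i).1 <-> exists2 m, seltime q k = Some m & m <= i.
Proof.
move=> DE.
suff inv i : [/\ (run D i).1 <= n, seltime q (run D i).1 = Some (run D i).2,
    forall k, k <= (run D i).1 -> exists2 m, seltime q k = Some m & m <= i &
    (run D i).1 < n -> forall j, (run D i).2 < j <= i ->
      ~~ q (run D i).1 (run D i).2 j].
  move=> i; have [cn tc le_c gt_c] := inv i; split => // k kn; split; first exact: le_c.
  move=> [m + mi]; rewrite leqNgt => tk; apply/negP => ck.
  have [m' tm' m'i] : exists2 m, seltime q (run D i).1.+1 = Some m & m <= i.
    elim: k kn ck m mi tk => // k IHk kn; rewrite ltnS leq_eqVlt.
    move=> /predU1P[<-|ck] m mi tk; first by exists m.
    by have [m' [tm' m'm _]] := seltimeS tk;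
      apply: (IHk (ltnW kn) ck m' _ tm'); exact: leq_trans (ltnW m'm) mi.
  have [l [+ lm' ql]] := seltimeS tm'; rewrite tc => -[El].
  have := gt_c (leq_trans ck kn) m'.
  by rewrite El lm' m'i ql => /(_ isT).
elim: i => [|i [cn tc le_c gt_c]].
  split => //= [k|_ j]; first by rewrite leqn0 => /eqP ->; exists 0.
  by rewrite leqn0 andbC; case: eqP => // ->.
have := DE i; rewrite /=; case: ifPn => /= [Di /esym /andP[cn' qi]|Di /esym /negbT].
  have tc' : seltime q (run D i).1.+1 = Some i.+1.
    rewrite /= tc /=; apply/first_afterP; split => //.
      by rewrite ltnS run_last_le.
    by move=> j /andP[lj ji]; apply: gt_c => //; rewrite lj.
  split => // [k|_ j /andP[]].
    rewrite leq_eqVlt => /predU1P[->|/le_c[m tm mi]]; first by exists i.+1.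
    by exists m => //; exact: leqW.
  by move=> /leq_trans /[apply]; rewrite ltnn.
rewrite negb_and => nq; split => // [k /le_c[m tm mi]|cn' j /andP[lj]].
  by exists m => //; exact: leqW.
rewrite leq_eqVlt => /predU1P[->|ji]; last by apply: gt_c => //; rewrite lj.
by move: nq; rewrite cn'.
Qed.

(** The decision depends on the state that the earlier decisions have produced,
    so the states are defined before the decisions. *)
Fixpoint greedy_run (n : nat) q (i : nat) : nat * nat :=
  if i is j.+1 then
    let s := greedy_run n q j in
    if (s.1 < n) && q s.1 s.2 j.+1 then (s.1.+1, j.+1) else s
  else (0, 0).

Definition greedy (n : nat) q (i : nat) : bool :=
  ((greedy_run n q i).1 < n) && q (greedy_run n q i).1 (greedy_run n q i).2 i.+1.

Lemma run_greedy n q i : run (greedy n q) i = greedy_run n q i.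
Proof. by elim: i => //= i ->. Qed.

Lemma greedyE n q i : greedy n q i =
  ((run (greedy n q) i).1 < n) &&
    q (run (greedy n q) i).1 (run (greedy n q) i).2 i.+1.
Proof. by rewrite run_greedy. Qed.

End Trajectories.

(** * Adapted decisions *)

Section Decisions.
Context {R : realType} {d : measure_display} {T : measurableType d}.
Variables (P : probability T R) (X : nat -> {RV P >-> R}).
Hypothesis X_indep : mutually_independent P (fun i => X i).
Hypothesis X_unif : forall i, uniform01 (X i).

Local Notation F := (nat_filtration (fun i => X i : T -> R)).
Local Notation mu := (@lebesgue_measure R).

Variables (n : nat) (D : nat -> T -> bool).

Definition selected (i : nat) (w : T) : nat := (run (D^~ w) i).1.
Definition level (i : nat) (w : T) : R := obs (fun i => X i : T -> R) (run (D^~ w) i).2 w.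

Definition remaining (i : nat) (w : T) : nat := n - selected i w.

Lemma selectedS i w : selected i.+1 w = if D i w then (selected i w).+1 else selected i w.
Proof. by rewrite /selected/=; case: ifP. Qed.

Lemma levelS i w : level i.+1 w = if D i w then X i w else level i w.
Proof. by rewrite /level/=; case: ifP. Qed.

Lemma remainingS i w : remaining i.+1 w = if D i w then (remaining i w).-1 else remaining i w.
Proof. by rewrite /remaining selectedS; case: ifP => // _; rewrite subnS. Qed.

(** The next state is made of the new observation or of the previous state,
    according to the decision. *)
Lemma decision_split i (A B C : set T) : F i.+1 [set w | D i w] -> F i B -> F i.+1 A ->
  (forall w, D i w -> C w <-> A w) -> (forall w, ~~ D i w -> C w <-> B w) ->
  F i.+1 C.
Proof.
move=> FD FB FA CA CB.
have -> : C = ([set w | D i w] `&` A) `|` (~` [set w | D i w] `&` B).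
  apply/seteqP; split => w /=.
    case: (boolP (D i w)) => Dw Cw; first by left; split => //; exact/CA.
    by right; split; [exact/negP|exact/CB].
  by move=> [[Dw /CA]|[/negP Dw /CB]]; exact.
apply: filtrationU; apply: filtrationI => //.
  exact: filtrationC.
exact: filtration_le FB.
Qed.

(** Only the earlier decisions are assumed to be adapted, for the sake of
    [markov_adapted], where this is known by induction. *)
Lemma state_adapted_from i k (B : set R) :
  (forall j, (j < i)%N -> F j.+1 [set w | D j w]) -> measurable B ->
  F i [set w | selected i w = k /\ B (level i w)].
Proof.
move=> + mB; elim: i k B mB => [|i IHi] k B mB FD.
  have [[k0 B0]|nkB] := pselect (0%N = k /\ B 0).
    rewrite (_ : [set w | _] = setT); first exact: filtrationT.
    by rewrite -subTset.
  rewrite (_ : [set w | _] = set0); first exact: filtration0.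
  by rewrite -subset0.
have {}IHi l (C : set R) (mC : measurable C) : F i [set w | selected i w = l /\ C (level i w)].
  by apply: IHi => // j ji; apply: FD; exact: leqW.
apply: (@decision_split i [set w | (0 < k)%N /\ selected i w = k.-1 /\ B (X i w)]
  _ _ (FD i (leqnn _)) (IHi k B mB)).
- case: k => [|k].
    rewrite (_ : [set w | _] = set0); first exact: filtration0.
    by rewrite -subset0 => w [].
  rewrite (_ : [set w | _] = [set w | selected i w = k /\ setT (level i w)] `&` X i @^-1` B).
    apply: filtrationI; last exact: filtrationX.
    by apply: (@filtration_le _ _ _ _ X i) => //; exact: IHi.
  by apply/seteqP; split => w /=; [move=> [_ []]|move=> [[]]].
- move=> w Dw; rewrite /= selectedS levelS Dw; case: k => [|k]/=.
    by split => [[]|[]].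
  by split => [[[->]]|[_ [-> ]]].
- by move=> w /negbTE Dw; rewrite /= selectedS levelS Dw.
Qed.

Hypothesis D_adapted : forall i, F i.+1 [set w | D i w].

Lemma state_adapted i k (B : set R) : measurable B ->
  F i [set w | selected i w = k /\ B (level i w)].
Proof. by apply: state_adapted_from => j _; exact: D_adapted. Qed.

Lemma selected_adapted i k : F i [set w | selected i w = k].
Proof.
rewrite (_ : mkset _ = [set w | selected i w = k /\ setT (level i w)]).
  exact: state_adapted.
by apply/seteqP; split => w //= [].
Qed.

(** Given the past, the next observation is uniform: an expectation involving
    the current state and the next observation is computed by integrating the
    latter first. *)
Lemma integral_next i (g : nat -> R -> R -> \bar R) :
  (forall r, measurable_fun setT (fun p : R * R => g r p.1 p.2)) ->
  (forall r y x, 0 <= g r y x)%E ->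
  (\int[P]_w g (remaining i w) (level i w) (X i w) =
   \int[P]_w \int[mu]_(x in `[0%R, 1%R]) g (remaining i w) (level i w) x)%E.
Proof.
move=> mg g0.
pose Z w := (remaining i w, level i w).
apply: (integral_freeze X_indep X_unif (Z := Z) (g := fun z x => g z.1 z.2 x)).
- move=> B mB.
  rewrite (_ : _ @^-1` _ =
    \bigcup_k [set w | selected i w = k /\ xsection B (n - k)%N (level i w)]).
    have [_ _ h] := filtration_salgebra X i; apply: h => k.
    by apply: state_adapted; exact: measurable_xsection.
  apply/seteqP; split => w; rewrite /Z /remaining/=.
    by move=> Bw; exists (selected i w) => //=; split => //; rewrite /xsection/= inE.
  by move=> [k _ /= [<-]]; rewrite /xsection/= inE.
- move=> _ B mB; rewrite setTI.
  rewrite (_ : _ @^-1` _ = \bigcup_k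
    ((fun p => p.1.1) @^-1` [set k] `&`
     (fun p : (nat * R) * R => (p.1.2, p.2)) @^-1`
       ((fun p : R * R => g k p.1 p.2) @^-1` B))).
    apply: bigcup_measurable => k _; apply: measurableI.
      rewrite -[X in measurable X]setTI.
      apply: (measurableT_comp measurable_fst measurable_fst) => //.
    rewrite -[X in measurable X]setTI.
    have mp : measurable_fun setT (fun p : (nat * R) * R => (p.1.2, p.2)).
      apply: measurable_fun_pair => //.
      exact: (measurableT_comp measurable_snd measurable_fst).
    apply: mp => //.
    by rewrite -[X in measurable X]setTI; exact: mg.
  apply/seteqP; split => -[[r y] x] /=.
    by move=> Bg; exists r.
  by move=> [k _ /= [-> ]].
- by move=> [r y] x; exact: g0.
Qed.

End Decisions.

Arguments selected_adapted {R d T P X D} _ i k.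
Arguments state_adapted {R d T P X D} _ i k [B] _.

(** * The lower bound for bounded subsolutions *)

Section OneStep.
Context {R : realType} {d : measure_display} {T : measurableType d}.
Variables (P : probability T R) (X : nat -> {RV P >-> R}).
Hypothesis X_indep : mutually_independent P (fun i => X i).
Hypothesis X_unif : forall i, uniform01 (X i).
Variables (n : nat) (D : nat -> T -> bool).
Local Notation F := (nat_filtration (fun i => X i : T -> R)).
Hypothesis D_adapted : forall i, F i.+1 [set w | D i w].

Local Notation mu := (@lebesgue_measure R).
Local Notation remaining := (remaining n D).
Local Notation level := (level X D).
Local Notation selected := (selected D).

Lemma measurable_selected i k : measurable [set w | selected i w = k].
Proof. exact: filtration_measurable (selected_adapted D_adapted i k). Qed.

Lemma measurable_level i : measurable_fun setT (level i).
Proof.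
move=> _ B mB; rewrite setTI (_ : _ @^-1` _ =
  \bigcup_k [set w | selected i w = k /\ B (level i w)]).
  apply: bigcup_measurable => k _.
  exact: (filtration_measurable (state_adapted D_adapted i k mB)).
by apply/seteqP; split => w //=; [exists (selected i w)|move=> [k _ /= []]].
Qed.

Lemma measurable_next {d'} {E : measurableType d'} i (g : nat -> R -> R -> E) :
  (forall r, measurable_fun setT (fun p : R * R => g r p.1 p.2)) ->
  measurable_fun setT (fun w => g (remaining i w) (level i w) (X i w)).
Proof.
move=> mg _ B mB; rewrite setTI (_ : _ @^-1` _ = \bigcup_k ([set w | selected i w = k] `&`
    (fun w => (level i w, X i w)) @^-1`
      ((fun p : R * R => g (n - k)%N p.1 p.2) @^-1` B))).
  apply: bigcup_measurable => k _; apply: measurableI; first exact: measurable_selected.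
  rewrite -[X in measurable X]setTI.
  have mp : measurable_fun setT (fun w => (level i w, X i w)).
    by apply: measurable_fun_pair => //; exact: measurable_level.
  by apply: mp => //; rewrite -[X in measurable X]setTI; exact: mg.
apply/seteqP; split => w; rewrite /remaining/=.
  by move=> Bg; exists (selected i w).
by move=> [k _ /= [<-]].
Qed.

Lemma measurable_state {d'} {E : measurableType d'} i (h : nat -> R -> E) :
  (forall r, measurable_fun setT (h r)) ->
  measurable_fun setT (fun w => h (remaining i w) (level i w)).
Proof.
move=> mh; apply: (@measurable_next _ _ i (fun r y _ => h r y)) => r.
exact: (measurableT_comp (mh r) measurable_fst).
Qed.

Lemma measurable_integral01 (g : R -> R -> \bar R) :
  measurable_fun setT (fun p : R * R => g p.1 p.2) -> (forall y x, 0 <= g y x)%E ->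
  measurable_fun setT (fun y => \int[mu]_(x in `[0%R, 1%R]) g y x)%E.
Proof.
move=> mg g0.
pose G := fun p : R * measurableTypeR R => if p.2 \in `[0, 1] then g p.1 p.2 else 0%E.
have G0 p : (0 <= G p)%E by rewrite /G; case: ifP.
have mG : measurable_fun setT G.
  apply: measurable_fun_ifT => //.
  apply: (@measurableT_comp _ _ _ _ _ _ (fun x : R => x \in `[0, 1])).
    apply: (measurable_fun_bool true); rewrite setTI.
    by rewrite (_ : _ @^-1` _ = `[0, 1]%classic)//; exact: measurable_itv.
  exact: measurable_snd.
have mF := @measurable_fun_fubini_tonelli_F _ _ R (measurableTypeR R) R mu G mG.
rewrite (_ : (fun y => _) = fubini_F mu G); first exact: mF.
apply/funext => y; apply/esym.
rewrite /fubini_F [RHS]integral_mkcond; apply: eq_integral => x _.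
by rewrite /G patchE/= mem_setE.
Qed.

Definition value_function (C : R) (h : nat -> R -> R) : Prop :=
  [/\ forall r, measurable_fun setT (h r), forall y, h 0%N y = 0 &
      forall r y, 0 <= h r y <= C].

Definition gain (h : nat -> R -> R) (r : nat) (y x : R) : R :=
  if (0 < r)%N && (y <= x) then Num.max 0 (h r y - h r.-1 x) else 0.

(** On average, an observation does not gain more than 1, the cost of waiting
    for it. *)
Definition subsolution (h : nat -> R -> R) : Prop := forall r y, (0 < r)%N ->
  0 <= y < 1 -> (\int[mu]_(x in `[0%R, 1%R]) (gain h r y x)%:E <= 1)%E.

Definition stateval (h : nat -> R -> R) (i : nat) : \bar R :=
  (\int[P]_w (h (remaining i w) (level i w))%:E)%E.

(** The loss due to the [i]-th decision not being the best one for [h]. On valid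
    paths the difference is nonnegative, see [gapE]. *)
Definition gap (h : nat -> R -> R) (i : nat) (w : T) : R :=
  Num.max 0 (h (remaining i.+1 w) (level i.+1 w) + gain h (remaining i w) (level i w) (X i w)
    - h (remaining i w) (level i w)).

Definition alive (i : nat) : set T := [set w | (0 < remaining i w)%N].

(** Selections are only required to be weakly increasing: ties have probability
    zero, and the intervals of threshold policies are closed. *)
Definition valid_path (w : T) : Prop := forall i, 0 <= X i w < 1 /\
  (D i w -> (0 < remaining i w)%N /\ level i w <= X i w).

Lemma level01 w i : (forall i, 0 <= X i w < 1) -> 0 <= level i w < 1.
Proof.
move=> X01; elim: i => [|i IHi]; first by rewrite /level/= lexx ltr01.
by rewrite levelS; case: ifP.
Qed.

Lemma measurable_alive i : measurable (alive i).
Proof.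
have := @measurable_state _ _ i (fun r _ => (0 < r)%N).
move=> /(_ (fun r => measurable_cst _)) /(_ measurableT [set true]).
by rewrite setTI; apply.
Qed.

Lemma gain_ge0 h r y x : 0 <= gain h r y x.
Proof. by rewrite /gain; case: ifP => // _; rewrite le_max lexx. Qed.

Lemma gap_ge0 h i w : 0 <= gap h i w.
Proof. by rewrite /gap le_max lexx. Qed.

Lemma gapE h i w : valid_path w ->
  h (remaining i w) (level i w) + gap h i w =
  h (remaining i.+1 w) (level i.+1 w) + gain h (remaining i w) (level i w) (X i w).
Proof.
move=> vw; rewrite /gap max_r; first by rewrite addrC subrK.
rewrite subr_ge0 remainingS levelS; case: ifPn => [Dw|_]; last by rewrite lerDl gain_ge0.
have [_ /(_ Dw) [r0 yx]] := vw i.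
by rewrite /gain r0 yx/= -lerBlDl le_max lexx orbT.
Qed.

Section Subsolution.
Variables (C : R) (h : nat -> R -> R).
Hypotheses (hC : value_function C h) (h_sub : subsolution h).

Lemma measurable_gain r : measurable_fun setT (fun p : R * R => gain h r p.1 p.2).
Proof.
have [mh _ _] := hC.
rewrite /gain; case: (0 < r)%N => /=; last exact: measurable_cst.
apply: measurable_fun_ifT; [|apply: measurable_maxr|exact: measurable_cst].
- by apply: measurable_fun_ler; [exact: measurable_fst|exact: measurable_snd].
- exact: measurable_cst.
- apply: measurable_funB.
    exact: (measurableT_comp (mh r) measurable_fst).
  exact: (measurableT_comp (mh r.-1) measurable_snd).
Qed.

Lemma measurable_stateval i : measurable_fun setT (fun w => h (remaining i w) (level i w)).
Proof. by have [mh _ _] := hC; exact: measurable_state. Qed.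

Lemma measurable_gain_next i :
  measurable_fun setT (fun w => gain h (remaining i w) (level i w) (X i w)).
Proof. exact: (@measurable_next _ _ i (gain h)) measurable_gain. Qed.

Lemma measurable_gap i : measurable_fun setT (gap h i).
Proof.
apply: measurable_maxr; first exact: measurable_cst.
apply: measurable_funB; last exact: measurable_stateval.
by apply: measurable_funD; [exact: measurable_stateval|exact: measurable_gain_next].
Qed.

Hypothesis D_valid : {ae P, forall w, valid_path w}.

Lemma mean_gain_le i :
  (\int[P]_w (gain h (remaining i w) (level i w) (X i w))%:E <= P (alive i))%E.
Proof.
rewrite (@integral_next _ _ _ P X X_indep X_unif n D D_adapted i
  (fun r y x => (gain h r y x)%:E)); last 2 first.
- by move=> r; apply/measurable_EFinP; exact: measurable_gain.
- by move=> r y x; rewrite lee_fin gain_ge0.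
have -> : P (alive i) = (\int[P]_w (\1_(alive i) w)%:E)%E.
  by rewrite integral_indic ?setIT//; exact: measurable_alive.
apply: ae_ge0_le_integral => //.
- by move=> w _; apply: integral_ge0 => x _; rewrite lee_fin gain_ge0.
- apply: (@measurable_state _ _ i (fun r y => \int[mu]_(x in `[0%R, 1%R]) (gain h r y x)%:E)%E) => r.
  apply: (@measurable_integral01 (fun y x => (gain h r y x)%:E)).
    by apply/measurable_EFinP; exact: measurable_gain.
  by move=> y x; rewrite lee_fin gain_ge0.
- by apply/measurable_EFinP/measurable_indic; exact: measurable_alive.
- have := D_valid; apply: filterS => w vw _.
  rewrite indicE; case: (boolP (w \in alive i)) => [|].
    by rewrite inE => wi; apply: h_sub => //; apply: level01 => j; have [] := vw j.
  rewrite notin_setE /alive /= => /negP /negbTE r0.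
  by rewrite integral0_eq// => x _; rewrite /gain r0.
Qed.

(** On a valid path, [h] decreases by the gain minus the gap, and the mean gain
    is at most 1 as long as selections remain. *)
Lemma stateval_step i :
  (stateval h i + \int[P]_w (gap h i w)%:E <= stateval h i.+1 + P (alive i))%E.
Proof.
have [mh _ h0C] := hC.
have h0 r y : (0 <= (h r y)%:E)%E by rewrite lee_fin; have /andP[] := h0C r y.
have ms j : measurable_fun setT (fun w => (h (remaining j w) (level j w))%:E).
  by apply/measurable_EFinP; exact: measurable_stateval.
apply: (@le_trans _ _ (stateval h i.+1 +
    \int[P]_w (gain h (remaining i w) (level i w) (X i w))%:E)%E); last first.
  by rewrite leeD2l// mean_gain_le.
rewrite /stateval -!ge0_integralD//; last 4 first.
- by move=> w _; rewrite lee_fin gain_ge0.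
- by apply/measurable_EFinP; exact: measurable_gain_next.
- by move=> w _; rewrite lee_fin gap_ge0.
- by apply/measurable_EFinP; exact: measurable_gap.
rewrite le_eqVlt; apply/orP; left; apply/eqP; apply: ge0_ae_eq_integral => //.
- by apply: emeasurable_funD => //; apply/measurable_EFinP; exact: measurable_gap.
- by apply: emeasurable_funD => //; apply/measurable_EFinP; exact: measurable_gain_next.
- by move=> w _; rewrite adde_ge0// lee_fin gap_ge0.
- by move=> w _; rewrite adde_ge0// lee_fin gain_ge0.
- by have := D_valid; apply: filterS => w vw _; rewrite -!EFinD gapE.
Qed.

(** Summing the one-step inequalities from the initial state [(n, 0)]. The sum
    of the gaps is kept, as it must vanish for an optimal policy. *)
Lemma lower_bound_gap N :
  ((h n 0)%:E + \sum_(i < N) \int[P]_w (gap h i w)%:E <=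
   C%:E * P (alive N) + \sum_(i < N) P (alive i))%E.
Proof.
have [mh hz h0C] := hC.
have -> : (h n 0)%:E = stateval h 0.
  rewrite /stateval /remaining /level /selected /= subn0.
  rewrite integral_cst// -[LHS]mule1; congr (_ * _)%E.
  exact/esym/probability_setT.
apply: (@le_trans _ _ (stateval h N + \sum_(i < N) P (alive i))%E).
  elim: N => [|N IHN]; first by rewrite !big_ord0.
  rewrite !big_ord_recr/= addeA.
  apply: le_trans (leeD2r _ IHN) _.
  rewrite addeAC [leRHS]addeCA [leRHS]addeC leeD2r//.
  exact: stateval_step.
rewrite leeD2r// /stateval.
have -> : P (alive N) = (\int[P]_w (\1_(alive N) w)%:E)%E.
  by rewrite integral_indic ?setIT//; exact: measurable_alive.
rewrite -ge0_integralZl//; last 2 first.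
- by apply/measurable_EFinP/measurable_indic; exact: measurable_alive.
- by rewrite lee_fin; have /andP[h1 h2] := h0C n 0; exact: le_trans h1 h2.
apply: ge0_le_integral => //.
- by move=> w _; rewrite lee_fin; have /andP[] := h0C (remaining N w) (level N w).
- by apply/measurable_EFinP; exact: measurable_stateval.
- apply: measurable_funeM; apply/measurable_EFinP/measurable_indic; exact: measurable_alive.
- move=> w _; rewrite -EFinM lee_fin indicE; case: (boolP (w \in alive N)) => [_|].
    by rewrite mulr1; have /andP[] := h0C (remaining N w) (level N w).
  by rewrite notin_setE /alive /= => /negP; rewrite -eqn0Ngt => /eqP ->; rewrite hz mulr0.
Qed.

End Subsolution.
End OneStep.

(** * The one-step equations of the value functions *)

Section ExplicitIntegrals.
Context {R : realType}.
Local Notation mu := (@lebesgue_measure R).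
Local Notation b := (@optv R).
Implicit Types (x y z : R).

Lemma integral_antiderivative (f F : R -> R) (y z : R) : y < z ->
  (forall x, y <= x <= z -> is_derive x 1 F (f x)) ->
  (forall x, y <= x <= z -> derivable f x 1) ->
  (\int[mu]_(x in `[y, z]) (f x)%:E = (F z - F y)%:E)%E.
Proof.
move=> yz dF df.
have cF x : y <= x <= z -> {for x, continuous F}.
  by move=> /dF[+ _] => /derivable1_diffP /differentiable_continuous.
rewrite (@continuous_FTC2 _ f F)//.
- by apply: derivable_within_continuous => x; rewrite in_itv/=; exact: df.
- split.
  + move=> x; rewrite in_itv/= => /andP[/ltW yx /ltW xz].
    by have /dF[] : y <= x <= z by rewrite yx.
  + by apply: cvg_at_right_filter; apply: cF; rewrite lexx ltW.
  + by apply: cvg_at_left_filter; apply: cF; rewrite lexx ltW.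
- move=> x; rewrite in_itv/= => /andP[/ltW yx /ltW xz].
  by rewrite derive1E; have /dF[_ ->] : y <= x <= z by rewrite yx.
Qed.

(** The expected time to see an observation above [y], with the default value 0
    for [1 <= y], an event of probability zero. *)
Definition inv1 (y : R) : R := if y < 1 then (1 - y)^-1 else 0.

Lemma inv1E y : y < 1 -> inv1 y = (1 - y)^-1.
Proof. by rewrite /inv1 => ->. Qed.

Lemma inv1_ge0 y : 0 <= inv1 y.
Proof. by rewrite /inv1; case: ifP => // y1; rewrite invr_ge0; lra. Qed.

Lemma is_derive_inv1B x : x < 1 -> is_derive x 1 (fun v => (1 - v)^-1) ((1 - x) ^- 2).
Proof.
move=> x1; have x0 : 1 - x != 0 by lra.
have d1 : is_derive x 1 (fun v : R => 1 - v) (- 1).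
  have := is_deriveB (is_derive_cst (1 : R) x 1) (is_derive_id x 1).
  by rewrite sub0r.
have dV : derivable (fun v : R => 1 - v) x 1 by have [] := d1.
apply: DeriveDef; first exact: (@derivableV _ _ (fun v : R => 1 - v)).
rewrite (@deriveV _ _ (fun v : R => 1 - v))//.
by have [_ ->] := d1; rewrite /GRing.scale/= mulrN1 opprK.
Qed.

Lemma is_derive_lnB x : x < 1 -> is_derive x 1 (fun v => - ln (1 - v)) ((1 - x)^-1).
Proof.
move=> x1.
have d1 : is_derive x 1 (fun v : R => 1 - v) (- 1).
  have := is_deriveB (is_derive_cst (1 : R) x 1) (is_derive_id x 1).
  by rewrite sub0r.
have dl : is_derive (1 - x) 1 (@ln R) (1 - x)^-1 by apply: is_derive1_ln; lra.
have := is_deriveN (@is_derive1_comp _ (@ln R) (fun v => 1 - v) x _ _ dl d1).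
by rewrite mulrN1 opprK.
Qed.

Lemma measurable_inv1 : measurable_fun setT inv1.
Proof.
apply: measurable_fun_if => //; first exact: measurable_fun_ltr.
rewrite setTI (_ : _ @^-1` _ = `]-oo, 1[%classic); last first.
  by apply/seteqP; split => x /=; rewrite in_itv/=.
apply: open_continuous_measurable_fun; first exact: interval_open.
move=> x; rewrite inE/= in_itv/= => x1.
have [+ _] := is_derive_inv1B x1.
by move=> /derivable1_diffP /differentiable_continuous.
Qed.

Lemma integral_inv1 y z : 0 <= y -> y < z -> z < 1 ->
  (\int[mu]_(x in `[y, z]) (inv1 x)%:E = (ln ((1 - y) / (1 - z)))%:E)%E.
Proof.
move=> y0 yz z1.
transitivity (\int[mu]_(x in `[y, z]) ((1 - x)^-1)%:E)%E.
  by apply: eq_integral => x; rewrite inE/= in_itv/= => /andP[_ xz]; rewrite inv1E//; lra.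
rewrite ln_div ?posrE; [|lra|lra].
rewrite addrC -[ln (1 - y)]opprK.
apply: (@integral_antiderivative (fun v => (1 - v)^-1) (fun v => - ln (1 - v))) => // x xyz.
  by apply: is_derive_lnB; lra.
have x1 : x < 1 by lra.
by have [] := is_derive_inv1B x1.
Qed.

Lemma integral_inv1_sq y z : 0 <= y -> y < z -> z < 1 ->
  (\int[mu]_(x in `[y, z]) (inv1 x ^+ 2)%:E = ((1 - z)^-1 - (1 - y)^-1)%:E)%E.
Proof.
move=> y0 yz z1.
transitivity (\int[mu]_(x in `[y, z]) ((1 - x) ^- 2)%:E)%E.
  apply: eq_integral => x; rewrite inE/= in_itv/= => /andP[_ xz].
  by rewrite inv1E ?exprVn//; lra.
apply: (@integral_antiderivative (fun v => (1 - v) ^- 2) (fun v => (1 - v)^-1)) => // x xyz.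
  by apply: is_derive_inv1B; lra.
have x1 : x < 1 by lra.
have [dx _] := is_derive_inv1B x1.
rewrite (_ : (fun v => _) = (fun v => (1 - v)^-1 * (1 - v)^-1)).
  exact: (derivableM dx dx).
by apply/funext => v; rewrite expr2 invfM.
Qed.

(** At this observation, selecting and waiting are equally good; see
    [le_edge]. *)
Definition edge (r : nat) (y : R) : R := y + @optt R r * (1 - y).

Lemma edge_gt r y : y < 1 -> y < edge r.+1 y.
Proof. by move=> y1; rewrite /edge ltrDl mulr_gt0 ?optt_gt0//; lra. Qed.

Lemma edge_le1 r y : y < 1 -> edge r.+1 y <= 1.
Proof.
move=> y1; rewrite /edge -lerBrDl ger_pMl ?optt_le1//; lra.
Qed.

Lemma edgeE r y : b r.+1 * (1 - edge r.+1 y) = b r * (1 - y).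
Proof. by rewrite /edge -(optv_optt r); ring. Qed.

Lemma edge_lt1 r y : y < 1 -> edge r.+2 y < 1.
Proof.
move=> y1; have h := edgeE r.+1 y.
have b1 := @optv_gt0 R r; have b2 := @optv_gt0 R r.+1.
by rewrite -subr_gt0 -(pmulr_rgt0 _ b2) h mulr_gt0// subr_gt0.
Qed.

Lemma le_edge r y x : y < 1 -> x < 1 ->
  (x <= edge r.+1 y) = (b r * inv1 x <= b r.+1 * inv1 y).
Proof.
move=> y1 x1; rewrite !inv1E//.
rewrite ler_pdivrMr; last lra.
rewrite mulrAC ler_pdivlMr; last lra.
rewrite -edgeE ler_pM2l ?optv_gt0//.
by apply/idP/idP; lra.
Qed.

Lemma edge1 y : edge 1 y = 1.
Proof. by rewrite /edge /optt/= mul0r subr0; ring. Qed.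

Lemma measure_window r y : 0 <= y < 1 ->
  mu `[y, edge r.+1 y]%classic = (@optt R r.+1 * (1 - y))%:E.
Proof.
move=> /andP[y0 y1]; rewrite lebesgue_measure_itv/= lte_fin edge_gt//.
by rewrite -EFinD /edge; congr (_%:E); ring.
Qed.

(** For [r = 0] the interval extends to 1, where [inv1] is not integrable, but
    then [b r = 0]. *)
Lemma integral_window1 r y : 0 <= y < 1 ->
  (\int[mu]_(x in `[y, edge r.+1 y]) (b r * inv1 x)%:E =
   (b r * ln (b r.+1 / b r))%:E)%E.
Proof.
move=> /andP[y0 y1]; case: r => [|r].
  rewrite optv0 mul0r integral0_eq// => x _; by rewrite mul0r.
under eq_integral do rewrite EFinM.
rewrite ge0_integralZl//; last 3 first.
- by apply/measurable_EFinP/measurable_funTS; exact: measurable_inv1.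
- by move=> x _; rewrite lee_fin inv1_ge0.
- by rewrite lee_fin optv_ge0.
rewrite integral_inv1 ?edge_gt ?edge_lt1// -EFinM; congr (_ * ln _)%:E.
have e1 := edge_lt1 r y1; have := edgeE r.+1 y.
have := @optv_gt0 R r; have := @optv_gt0 R r.+1 => b1 b2 h.
apply/eqP; rewrite eqr_div; [|lra|lra].
by rewrite h mulrC.
Qed.

Lemma integral_window2 (c : R) r y : 0 <= c -> 0 <= y < 1 ->
  (\int[mu]_(x in `[y, edge r.+1 y]) (c * b r * inv1 x ^+ 2)%:E =
   (c * (b r.+1 - b r) * inv1 y *+ (0 < r)%N)%:E)%E.
Proof.
move=> c0 /andP[y0 y1]; case: r => [|r].
  by rewrite optv0 mulr0n integral0_eq// => x _; rewrite mulr0 mul0r.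
under eq_integral do rewrite EFinM.
rewrite ge0_integralZl//; last 3 first.
- apply/measurable_EFinP/measurable_funTS.
  by apply: measurable_funX; exact: measurable_inv1.
- by move=> x _; rewrite lee_fin exprn_ge0// inv1_ge0.
- by rewrite lee_fin mulr_ge0// optv_ge0.
rewrite integral_inv1_sq ?edge_gt ?edge_lt1// -EFinM inv1E//; congr (_%:E).
have e1 := edge_lt1 r y1; have h := edgeE r.+1 y.
have b1 := @optv_gt0 R r; have b2 := @optv_gt0 R r.+1.
have -> : (1 - edge r.+2 y)^-1 = b r.+2 / (b r.+1 * (1 - y)).
  by rewrite -h; field; lra.
by rewrite mulr1n; field; lra.
Qed.

End ExplicitIntegrals.

Section Truncation.
Context {R : realType}.
Local Notation mu := (@lebesgue_measure R).
Local Notation b := (@optv R).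
Implicit Types (x y z C : R).

(** The truncation at [C] of the solution of the Bellman equation. Being bounded,
    it is integrable along any policy. Its value for [1 <= y] is the limit at 1
    when [r] is positive. *)
Definition trunc C (r : nat) y : R :=
  if r is 0 then 0 else if y < 1 then Num.min C (b r * inv1 y) else C.

Lemma trunc_value_function C : 0 <= C -> value_function C (trunc C).
Proof.
move=> C0; split => //.
- case=> [|r] /=; first exact: measurable_cst.
  apply: measurable_fun_ifT => //; first exact: measurable_fun_ltr.
  apply: measurable_minr => //.
  by apply: measurable_funM => //; exact: measurable_inv1.
- case=> [|r] y /=; first by rewrite lexx.
  case: ifP => _; last by rewrite C0 lexx.
  apply/andP; split; last by rewrite ge_min lexx.
  by rewrite le_min C0 mulr_ge0 ?optv_ge0 ?inv1_ge0.
Qed.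

Lemma truncE C r y : y < 1 -> b r * inv1 y <= C -> trunc C r y = b r * inv1 y.
Proof.
by case: r => [|r] y1 bC /=; [rewrite optv0 mul0r|rewrite y1 min_r].
Qed.

Definition window (r : nat) y : set R := `[y, edge r y]%classic.

Lemma window01 r y : 0 <= y < 1 -> window r.+1 y `<=` `[0, 1]%classic.
Proof.
move=> /andP[y0 y1] x; rewrite /window /= !in_itv/= => /andP[yx xe].
by apply/andP; split; [exact: le_trans yx|exact: le_trans (edge_le1 r y1)].
Qed.

Lemma measurable_window r y : measurable (window r y).
Proof. exact: measurable_itv. Qed.

Lemma integral_window_cst (c : R) r y : 0 <= y < 1 ->
  (\int[mu]_(x in window r.+1 y) c%:E = (c * (@optt R r.+1 * (1 - y)))%:E)%E.
Proof.
move=> y01; rewrite integral_cst; last exact: measurable_window.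
by rewrite EFinM; congr (_ * _)%E; exact: measure_window.
Qed.

(** The Bellman equation again: the expected gain of the next observation is 1,
    the cost of waiting for it. *)
Lemma integral_gain r y : 0 <= y < 1 ->
  (\int[mu]_(x in window r.+1 y) (b r.+1 * inv1 y - b r * inv1 x)%:E = 1)%E.
Proof.
move=> y01; have /andP[y0 y1] := y01.
have gain0 x : window r.+1 y x -> (0 <= (b r.+1 * inv1 y - b r * inv1 x)%:E)%E.
  rewrite /window /= in_itv /= => /andP[yx xe]; rewrite lee_fin subr_ge0.
  have [x1|x1] := ltP x 1; first by rewrite -le_edge.
  by rewrite {1}/inv1 ltNge x1/= mulr0 mulr_ge0 ?optv_ge0 ?inv1_ge0.
have mb : measurable_fun setT (fun x => b r * inv1 x).
  by apply: measurable_funM => //; exact: measurable_inv1.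
set A := (\int[mu]_(x in _) _)%E.
have : (A + (b r * ln (b r.+1 / b r))%:E = (b r.+1 - b r)%:E)%E.
  rewrite -(integral_window1 r y01) -ge0_integralD//=; first last.
  - by apply/measurable_EFinP/measurable_funTS.
  - by move=> x _; rewrite lee_fin mulr_ge0 ?optv_ge0 ?inv1_ge0.
  - apply/measurable_EFinP/measurable_funTS; apply: measurable_funB => //.
  - exact: measurable_window.
  under eq_integral do rewrite -EFinD subrK.
  rewrite (integral_window_cst _ r y01) inv1E//; congr (_%:E).
  by rewrite -[in RHS](optv_optt r); field; lra.
rewrite optv_rec EFinD => h.
have := congr1 (fun e : \bar R => e - (b r * ln (b r.+1 / b r))%:E)%E h.
by rewrite !addeK.
Qed.

(** Truncation is nondecreasing and 1-Lipschitz, so it does not increase the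
    gains. *)
Lemma gain_trunc_le C r y x : 0 <= C -> 0 <= y < 1 -> 0 <= x <= 1 ->
  gain (trunc C) r.+1 y x <=
    if x \in `[y, edge r.+1 y] then b r.+1 * inv1 y - b r * inv1 x else 0.
Proof.
move=> C0 /andP[y0 y1] /andP[x0 x1]; rewrite /gain /= in_itv/= y1.
have [yx|//] := leP y x; rewrite /=.
have [xE|xE] := eqVneq x 1.
  rewrite xE; case: r => [|r]/=.
    by rewrite edge1 lexx optv0 mul0r !subr0 ge_max ge_min lexx orbT mulr_ge0 ?optv_ge0 ?inv1_ge0.
  have -> : (1 <= edge r.+2 y) = false by apply/negbTE; rewrite -ltNge edge_lt1.
  by rewrite ltxx max_l// subr_le0 ge_min lexx.
have {x1 xE} x1 : x < 1 by rewrite lt_neqAle xE.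
rewrite le_edge//; case: r => [|r]/=.
  have V0 : 0 <= b 1 * inv1 y by rewrite mulr_ge0 ?optv_ge0 ?inv1_ge0.
  by rewrite optv0 mul0r !subr0 V0 ge_max V0 ge_min lexx orbT.
rewrite x1; set V := b r.+2 * _; set V' := b r.+1 * _.
have [VV'|VV'] := leP V' V; rewrite ge_max ?lexx/=.
  rewrite subr_ge0 VV'/=.
  by case: (leP C V); case: (leP C V'); lra.
by case: (leP C V); case: (leP C V'); lra.
Qed.

Lemma trunc_subsolution C : 0 <= C -> subsolution (trunc C).
Proof.
move=> C0 [//|r] y _ y01.
rewrite -(integral_gain r y01).
have mp : measurable_fun setT (fun x : R => (y, x)) by exact: measurable_fun_pair.
have mg : measurable_fun setT (fun x : R => (gain (trunc C) r.+1 y x)%:E).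
  apply/measurable_EFinP.
  exact: (measurableT_comp (measurable_gain (trunc_value_function C0) r.+1) mp).
have mw : measurable_fun setT (fun x : R => (b r.+1 * inv1 y - b r * inv1 x)%:E).
  apply/measurable_EFinP; apply: measurable_funB => //.
  by apply: measurable_funM => //; exact: measurable_inv1.
rewrite [leRHS]integral_mkcond [leLHS]integral_mkcond.
apply: ge0_le_integral => //.
- by move=> x _; rewrite patchE; case: ifP => // _; rewrite lee_fin gain_ge0.
- apply/(measurable_restrictT _ _).1; first exact: measurable_itv.
  by apply: measurable_funTS; exact: mg.
- apply/(measurable_restrictT _ _).1; first exact: measurable_itv.
  by apply: measurable_funTS; exact: mw.
- move=> x _; rewrite !patchE.
  have gx := gain_trunc_le r C0 y01.
  case: ifPn => [|_].
    rewrite inE /= in_itv /= => /gx; rewrite mem_setE; case: ifP => _; rewrite lee_fin//.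
  case: ifPn => // ; rewrite inE /window/= in_itv/= => /andP[yx xe].
  rewrite lee_fin subr_ge0.
  have [x1|x1] := ltP x 1; first by rewrite -le_edge//; case/andP: y01.
  by rewrite {1}/inv1 ltNge x1/= mulr0 mulr_ge0 ?optv_ge0 ?inv1_ge0.
Qed.

End Truncation.

(** * The optimal threshold policy *)

Section ThresholdDecisions.
Context {R : realType} {d : measure_display} {T : measurableType d}.
Variables (P : probability T R) (X : nat -> {RV P >-> R}).
Local Notation F := (nat_filtration (fun i => X i : T -> R)).

Lemma filtration_pair i (Y Z : T -> R) :
  (forall B, measurable B -> F i (Y @^-1` B)) ->
  (forall B, measurable B -> F i (Z @^-1` B)) ->
  forall B : set (R * R), measurable B -> F i ((fun w => (Y w, Z w)) @^-1` B).
Proof.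
move=> FY FZ; rewrite measurable_prod_measurableType.
pose G : set (set (R * R)) := [set B | F i ((fun w => (Y w, Z w)) @^-1` B)].
apply: (@smallest_sub _ (sigma_algebra setT) _ G).
  split; rewrite /G /=.
  - by rewrite preimage_set0; exact: filtration0.
  - by move=> A FA; rewrite setTD preimage_setC; exact: filtrationC.
  - move=> A FA; rewrite preimage_bigcup.
    by have [_ _ h] := filtration_salgebra X i; exact: h.
move=> _ [A mA [B mB <-]]; rewrite /G /=.
rewrite (_ : _ @^-1` _ = Y @^-1` A `&` Z @^-1` B)//.
by apply: filtrationI; [exact: FY|exact: FZ].
Qed.

(** By strong induction: the state at time [i] depends only on the earlier
    decisions and observations. *)
Lemma markov_adapted n (D : nat -> T -> bool) (W : nat -> set (R * R)) :
  (forall r, measurable (W r)) ->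
  (forall i w, D i w <-> W (remaining n D i w) (level X D i w, X i w)) ->
  forall i, F i.+1 [set w | D i w].
Proof.
move=> mW DW; elim/ltn_ind => i IHi.
have FS k (B : set R) : measurable B ->
    F i [set w | selected D i w = k /\ B (level X D i w)].
  by move=> mB; apply: state_adapted_from => //.
rewrite (_ : [set w | D i w] = \bigcup_k ([set w | selected D i w = k /\ setT (level X D i w)] `&`
    (fun w => (level X D i w, X i w)) @^-1` W (n - k)%N)); last first.
  apply/seteqP; split => w /=.
    by move=> /DW; exists (selected D i w).
  by move=> [k _ [[<- _] Ww]]; exact/DW.
have [_ _ h] := filtration_salgebra X i.+1; apply: h => k.
apply: filtrationI.
  by apply: (@filtration_le _ _ _ _ X i) => //; exact: FS.
apply: filtration_pair => // B mB; last exact: filtrationX.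
apply: (@filtration_le _ _ _ _ X i) => //.
rewrite (_ : _ @^-1` _ = \bigcup_k [set w | selected D i w = k /\ B (level X D i w)]).
  by have [_ _ h'] := filtration_salgebra X i; apply: h' => l; exact: FS.
by apply/seteqP; split => w //=; [exists (selected D i w)|move=> [l _ /= []]].
Qed.

Definition thr_accept (n : nat) (t : nat -> R) (w : T) (k m i : nat) : bool :=
  obs (fun i => X i : T -> R) i w \in
    `[obs (fun i => X i : T -> R) m w, obs (fun i => X i : T -> R) m w
      + t (n - k)%N * (1 - obs (fun i => X i : T -> R) m w)].

Definition thr_decide (n : nat) (t : nat -> R) (i : nat) (w : T) : bool :=
  greedy n (thr_accept n t w) i.

Lemma threshold_time_seltime n t k w :
  threshold_time (fun i => X i : T -> R) n t k w = seltime (thr_accept n t w) k.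
Proof. by elim: k => //= k ->. Qed.

Lemma thr_decideE n t i w : thr_decide n t i w =
  (0 < remaining n (thr_decide n t) i w)%N &&
  (X i w \in `[level X (thr_decide n t) i w, level X (thr_decide n t) i w +
     t (remaining n (thr_decide n t) i w) * (1 - level X (thr_decide n t) i w)]).
Proof. by rewrite {1}/thr_decide greedyE subn_gt0. Qed.

Lemma thr_decide_adapted n t i : F i.+1 [set w | thr_decide n t i w].
Proof.
pose W r : set (R * R) := [set p | (0 < r)%N /\ p.1 <= p.2 /\ p.2 <= p.1 + t r * (1 - p.1)].
apply: (@markov_adapted n _ W) => [r|j w]; last first.
  rewrite thr_decideE in_itv/= /W/=.
  by split => [/and3P[]|[-> [-> ->]]].
have m1 : measurable_fun setT (fun p : R * R => p.1) by exact: measurable_fst.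
have m2 : measurable_fun setT (fun p : R * R => p.2) by exact: measurable_snd.
have mle : measurable_fun setT (fun p : R * R =>
    [&& (0 < r)%N, p.1 <= p.2 & p.2 <= p.1 + t r * (1 - p.1)]).
  apply: measurable_and; first exact: measurable_cst.
  apply: measurable_and; first exact: measurable_fun_ler.
  apply: measurable_fun_ler => //; apply: measurable_funD => //.
  by apply: measurable_funM => //; exact: measurable_funB.
rewrite (_ : W r = setT `&` (fun p : R * R =>
    [&& (0 < r)%N, p.1 <= p.2 & p.2 <= p.1 + t r * (1 - p.1)]) @^-1` [set true]).
  exact: mle.
by rewrite setTI; apply/seteqP; split => p; rewrite /W /=;
  [move=> [-> [-> ->]]|move=> /and3P[]].
Qed.

End ThresholdDecisions.

Section Evaluation.
Context {R : realType} {d : measure_display} {T : measurableType d}.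
Variables (P : probability T R) (X : nat -> {RV P >-> R}).
Hypothesis X_indep : mutually_independent P (fun i => X i).
Hypothesis X_unif : forall i, uniform01 (X i).
Hypothesis X01 : {ae P, forall w, forall i, 0 <= X i w < 1}.
Variable n : nat.

Local Notation mu := (@lebesgue_measure R).
Local Notation b := (@optv R).
Local Notation D := (thr_decide X n (@optt R)).
Local Notation remaining := (remaining n D).
Local Notation level := (level X D).
Local Notation stateval := (stateval X n D).
Local Notation alive := (alive n D).

Lemma opt_decideE i w :
  D i w = (0 < remaining i w)%N && (X i w \in `[level i w, edge (remaining i w) (level i w)]).
Proof. exact: thr_decideE. Qed.

(** The optimal policy selects only observations which do not increase the value
    of the state. This makes functions of the state bounded along its
    trajectories. *)
Lemma opt_value_le w i : (forall i, 0 <= X i w < 1) ->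
  b (remaining i w) * inv1 (level i w) <= b n.
Proof.
move=> X01w; elim: i => [|i IHi].
  by rewrite /remaining /selected/= subn0 /level/= inv1E ?ltr01// subr0 invr1 mulr1.
rewrite remainingS levelS; case: ifP => // ; rewrite opt_decideE => /andP[r0].
rewrite in_itv/= => /andP[_]; case: (remaining i w) r0 IHi => //= r _ IHi.
have /andP[_ l1] := level01 D i X01w; have /andP[_ x1] := X01w i.
by rewrite le_edge// => /le_trans; apply.
Qed.

Definition next_value (h : nat -> R -> R) (r : nat) (y x : R) : R :=
  if (0 < r)%N && (x \in `[y, edge r y]) then h r.-1 x else h r y.

Lemma integral_next_value (h : nat -> R -> R) (r : nat) (y : R) : (forall r, measurable_fun setT (h r)) ->
  (forall r y, 0 <= h r y) -> 0 <= y < 1 ->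
  (\int[mu]_(x in `[0%R, 1%R]) (next_value h r.+1 y x)%:E =
   \int[mu]_(x in window r.+1 y) (h r x)%:E +
     ((1 - @optt R r.+1 * (1 - y)) * h r.+1 y)%:E)%E.
Proof.
move=> mh h0 y01; have Wsub := @window01 R r y y01.
have mW : measurable (window r.+1 y) by exact: measurable_window.
have m01 : measurable (`[0, 1]%classic : set R) by exact: measurable_itv.
rewrite -{1}(setDUK Wsub).
have mwin : measurable_fun setT (fun x : R => x \in `[y, edge r.+1 y]).
  apply: (measurable_fun_bool true); rewrite setTI.
  by rewrite (_ : _ @^-1` _ = `[y, edge r.+1 y]%classic).
have mn : measurable_fun setT (fun x => (next_value h r.+1 y x)%:E).
  apply/measurable_EFinP; apply: measurable_fun_ifT => //.
have n0 x : (0 <= (next_value h r.+1 y x)%:E)%E.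
  by rewrite lee_fin /next_value; case: ifP.
rewrite ge0_integral_setU//=.
- congr (_ + _)%E.
    by apply: eq_integral => x; rewrite inE /window/= /next_value/= => ->.
  transitivity (\int[mu]_(x in `[0%R, 1%R]%classic `\` window r.+1 y) (h r.+1 y)%:E)%E.
    apply: eq_integral => x; rewrite inE /window /= => -[_ /negP/negbTE xW].
    by rewrite /next_value/= xW.
  rewrite integral_cst; last exact: measurableD.
  rewrite [in RHS]mulrC EFinM; congr (_ * _)%E.
  have mu1 : mu `[0, 1]%classic = 1%E.
    by rewrite lebesgue_measure_itv/= lte_fin ltr01 -EFinD subr0.
  transitivity (mu `[0%R, 1%R]%classic - mu (window r.+1 y))%E.
    rewrite -{2}(setIidr Wsub); apply: measureD => //.
    by apply: (@le_lt_trans _ _ 1%E); rewrite ?ltry// -mu1.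
  by rewrite mu1 measure_window// -EFinB.
- exact: measurableD.
- by apply: measurable_funTS.
- by rewrite disj_set2E setDIK.
Qed.

(** The next observation is integrated first, by [integral_next]. Once all the
    selections are made, both sides vanish. *)
Lemma stateval_next (h q : nat -> R -> R) (i : nat) :
  (forall r, measurable_fun setT (h r)) -> (forall r, measurable_fun setT (q r)) ->
  (forall r y, 0 <= h r y) -> (forall r y, 0 <= q r y) ->
  (forall y, h 0%N y = 0) -> (forall y, q 0%N y = 0) ->
  (forall r (y : R), 0 <= y < 1 ->
    (\int[mu]_(x in window r.+1 y) (h r x)%:E + (q r.+1 y)%:E =
      (@optt R r.+1 * (1 - y) * h r.+1 y)%:E)%E) ->
  (stateval h i = stateval h i.+1 + stateval q i)%E.
Proof.
move=> mh mq h0 q0 hz qz hq.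
have DA := @thr_decide_adapted _ _ _ P X n (@optt R).
have nextE w : h (remaining i.+1 w) (level i.+1 w) =
    next_value h (remaining i w) (level i w) (X i w).
  by rewrite remainingS levelS /next_value -opt_decideE; case: ifP.
have mnv r : measurable_fun setT (fun p : R * R => next_value h r p.1 p.2).
  have m1 : measurable_fun setT (fun p : R * R => p.1) by exact: measurable_fst.
  have m2 : measurable_fun setT (fun p : R * R => p.2) by exact: measurable_snd.
  apply: measurable_fun_ifT.
  - apply: measurable_and; first exact: measurable_cst.
    rewrite (_ : (fun p => _) = (fun p : R * R => (p.1 <= p.2) && (p.2 <= edge r p.1))).
      apply: measurable_and; first exact: measurable_fun_ler.
      apply: measurable_fun_ler => //; apply: measurable_funD => //.
      by apply: measurable_funM => //; exact: measurable_funB.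
    by apply/funext => p; rewrite in_itv.
  - exact: (measurableT_comp (mh _) m2).
  - exact: (measurableT_comp (mh _) m1).
have nv0 r y x : (0 <= (next_value h r y x)%:E)%E.
  by rewrite lee_fin /next_value; case: ifP.
rewrite {2}/stateval; under [X in (X + _)%E]eq_integral do rewrite nextE.
rewrite (@integral_next _ _ _ P X X_indep X_unif n D DA i
  (fun r y x => (next_value h r y x)%:E))//; last first.
  by move=> r; apply/measurable_EFinP.
have msq : measurable_fun setT (fun w => (q (remaining i w) (level i w))%:E).
  by apply/measurable_EFinP; exact: (measurable_state n DA i).
have msn : measurable_fun setT (fun w =>
    (\int[mu]_(x in `[0%R, 1%R]) (next_value h (remaining i w) (level i w) x)%:E)%E).
  apply: (measurable_state n DA i (h := fun r y =>
    \int[mu]_(x in `[0%R, 1%R]) (next_value h r y x)%:E)%E) => r.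
  apply: (@measurable_integral01 _ (fun y x => (next_value h r y x)%:E)) => //.
  exact/measurable_EFinP.
have sn0 w : (0 <= \int[mu]_(x in `[0%R, 1%R]) (next_value h (remaining i w) (level i w) x)%:E)%E.
  by apply: integral_ge0.
rewrite /stateval -ge0_integralD//; last by move=> w _; rewrite lee_fin.
apply: ge0_ae_eq_integral => //.
- by apply/measurable_EFinP; exact: (measurable_state n DA i).
- exact: emeasurable_funD.
- by move=> w _; rewrite lee_fin.
- by move=> w _; rewrite adde_ge0// lee_fin.
have := X01; apply: filterS => w X01w _.
have y01 := level01 D i X01w.
case: (remaining i w) => [|r].
  rewrite hz qz adde0 (_ : (fun x => _) = cst 0%E) ?integral0//.
  by apply/funext => x; rewrite /next_value/= hz.
rewrite integral_next_value// addeAC hq// -EFinD; congr (_%:E); ring.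
Qed.

End Evaluation.

(** * Moments of the time of the last selection *)

Section TailSums.
Context {R : realType}.

Lemma eseries_telescope (a r : nat -> R) (l : R) : r @ \oo --> 0 ->
  (forall N, \sum_(i < N) a i = l - r N) ->
  (\sum_(0 <= i <oo) (a i)%:E = l%:E)%E.
Proof.
move=> r0 aE; apply/cvg_lim => //.
rewrite (_ : (fun N => _) = (EFin \o (fun N => l - r N))); last first.
  by apply/funext => N /=; rewrite big_mkord sumEFin aE.
apply: cvg_EFin; first by near=> N.
rewrite -[X in _ --> X]subr0; apply: cvgB => //; exact: cvg_cst.
Unshelve. all: by end_near. Qed.

Lemma cvg0_le_tail (p : nat -> R) (B : R) :
  (forall i, 0 <= p i) -> (forall N, \sum_(i < N) p i <= B) -> p @ \oo --> 0.
Proof.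
move=> p0 pB; apply: cvg_series_cvg_0; apply: nondecreasing_is_cvgn.
  apply/nondecreasing_seqP => N; rewrite /series/= big_nat_recr//= lerDl; exact: p0.
by exists B => _ [N _ <-]; rewrite /series/= big_mkord; exact: pB.
Qed.

(** Both moments of a time, from the tails [p i] of its distribution: [v i] is
    the sum of the tails from [i] on, and [g i] the sum of the [v j], [i <= j]. *)
Lemma tail_sums (p v g : nat -> R) (A B : R) :
  (forall i, 0 <= p i) -> (forall i, 0 <= v i) -> (forall i, 0 <= g i) ->
  (forall i, v i = v i.+1 + p i) -> (forall i, g i = g i.+1 + v i) ->
  (forall i, v i <= A * p i) -> (forall i, g i <= B * p i) ->
  [/\ p @ \oo --> 0, (\sum_(0 <= i <oo) (p i)%:E = (v 0%N)%:E)%E &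
      (\sum_(0 <= i <oo) ((2 * i%:R + 1) * p i)%:E = (2 * g 0%N - v 0%N)%:E)%E].
Proof.
move=> p0 v0 g0 vS gS vA gB.
have sump N : \sum_(i < N) p i = v 0%N - v N.
  elim: N => [|N IHN]; first by rewrite big_ord0 subrr.
  by rewrite big_ord_recr/= IHN (vS N); ring.
have cp : p @ \oo --> 0.
  by apply: (@cvg0_le_tail p (v 0%N)) => // N; rewrite sump gerBl.
have cle (f : nat -> R) C : (forall i, 0 <= f i) -> (forall i, f i <= C * p i) -> f @ \oo --> 0.
  move=> f0 fC; apply: (@squeeze_cvgr _ _ _ _ (fun=> 0) (fun i => C * p i)).
  - by near=> i; rewrite f0 fC.
  - exact: cvg_cst.
  - by rewrite -(mulr0 C); apply: cvgM => //; exact: cvg_cst.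
have cv : v @ \oo --> 0 by exact: cle vA.
have cg : g @ \oo --> 0 by exact: cle gB.
have vle i j : (i <= j)%N -> v j <= v i.
  move=> /subnK <-; elim: (j - i)%N => [//|k IHk].
  by apply: le_trans IHk; rewrite addSn (vS (k + i)%N) lerDl.
have sumv N M : \sum_(i < M) v (N + i)%N = g N - g (N + M)%N.
  elim: M => [|M IHM]; first by rewrite big_ord0 addn0 subrr.
  by rewrite big_ord_recr/= IHM addnS (gS (N + M)%N); ring.
(* [v] is nonincreasing, so that [i * v i] is controlled by [g (i / 2)]. *)
have vhalf N : N%:R * v (N + N)%N <= g N.
  apply: (@le_trans _ _ (\sum_(i < N) v (N + i)%N)); last by rewrite sumv gerBl.
  rewrite mulr_natl -[X in _ *+ X]card_ord -sumr_const; apply: ler_sum => i _.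
  by apply: vle; rewrite leq_add2l ltnW.
have civ : (fun i => i%:R * v i) @ \oo --> 0.
  apply/cvgrPdist_lt => e e0.
  have e4 : 0 < e / 4 by rewrite divr_gt0.
  have /cvgrPdist_lt /(_ _ e4) [N1 _ gN] := cg.
  have /cvgrPdist_lt /(_ _ e4) [N2 _ vN] := cv.
  exists (maxn N1 N2).*2 => // i /= iN.
  have hN : (maxn N1 N2 <= i./2)%N by rewrite -[maxn _ _]doubleK half_leq.
  have {}gN : g i./2 < e / 4.
    have := gN i./2; rewrite /= sub0r normrN ger0_norm//; apply.
    by apply: leq_trans hN; rewrite leq_maxl.
  have {}vN : v i./2 < e / 4.
    have := vN i./2; rewrite /= sub0r normrN ger0_norm//; apply.
    by apply: leq_trans hN; rewrite leq_maxr.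
  rewrite sub0r normrN ger0_norm; last by rewrite mulr_ge0.
  have hi : (i./2 + i./2 <= i)%N by rewrite addnn -{2}(odd_double_half i) leq_addl.
  have ih : (i <= i./2 + i./2 + 1)%N.
    by rewrite addnn -{1}(odd_double_half i) addnC leq_add2l; case: odd.
  apply: (@le_lt_trans _ _ ((2 * i./2%:R + 1) * v (i./2 + i./2)%N)).
    apply: ler_pM => //; last exact: vle.
    by rewrite -[2]/(2%:R) -natrM natr1 ler_nat mul2n -addnn -addn1.
  have vv : v (i./2 + i./2)%N <= v i./2 by apply: vle; rewrite leq_addr.
  have := vhalf i./2; lra.
split => //.
  by apply: (@eseries_telescope p v) => // N; rewrite sump.
(* The weighted tails [(2 * i + 1) * p i] are the differences of this sequence. *)
apply: (@eseries_telescope _ (fun i => 2 * g i + (2 * i%:R - 1) * v i)) => [|N].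
  rewrite (_ : (fun i => _) = (fun i => 2 * g i + (2 * (i%:R * v i) - v i))); last first.
    by apply/funext => i; ring.
  rewrite [X in _ --> X](_ : 0 = 2 * 0 + (2 * 0 - 0) :> R); last by ring.
  apply: cvgD; first by apply: cvgM => //; exact: cvg_cst.
  by apply: cvgB => //; apply: cvgM => //; exact: cvg_cst.
elim: N => [|N IHN]; first by rewrite big_ord0; ring.
rewrite big_ord_recr/= IHN (gS N) (vS N) -natr1; ring.
Unshelve. all: by end_near. Qed.

End TailSums.

Section Times.
Context {R : realType} {d : measure_display} {T : measurableType d}.
Variable (P : probability T R) (X : nat -> {RV P >-> R}).
Local Notation F := (nat_filtration (fun i => X i : T -> R)).

Lemma stopping_adapted (tau : T -> option nat) i :
  stopping_time F tau -> F i [set w | tau w = Some i].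
Proof.
move=> st; case: i => [|i].
  rewrite (_ : mkset _ = [set w | exists2 m, tau w = Some m & (m <= 0)%N]); first exact: st.
  apply/seteqP; split => w /=; first by move=> tw; exact: (ex_intro2 _ _ 0%N tw (leqnn 0)).
  by move=> [m tm]; rewrite leqn0 => /eqP <-.
rewrite (_ : mkset _ = [set w | exists2 m, tau w = Some m & (m <= i.+1)%N] `&`
    ~` [set w | exists2 m, tau w = Some m & (m <= i)%N]).
  apply: filtrationI; first exact: st.
  by apply: filtrationC; apply: (@filtration_le _ _ _ _ X i) => //; exact: st.
apply/seteqP; split => w /=.
  move=> tw; split; first exact: (ex_intro2 _ _ i.+1 tw (leqnn _)).
  by rewrite tw => -[m [<-]]; rewrite ltnn.
move=> [[m tm mi] nm]; rewrite tm; congr Some; apply/eqP.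
rewrite eqn_leq mi /= ltnNge; apply/negP => mi'.
apply: nm; exact: (ex_intro2 _ _ m tm mi').
Qed.

Lemma measurable_stopping (tau : T -> option nat) i :
  stopping_time F tau -> measurable [set w | tau w = Some i].
Proof. by move=> st; apply: (@filtration_measurable _ _ _ P X i); exact: stopping_adapted. Qed.

Lemma measurable_rtime (tau : T -> option nat) :
  stopping_time F tau -> measurable_fun setT (rtime tau : T -> R).
Proof.
move=> st _ B mB; rewrite setTI.
have mall : measurable (\bigcup_i [set w | tau w = Some i]).
  by apply: bigcup_measurable => i _; exact: measurable_stopping.
rewrite (_ : _ @^-1` _ = (\bigcup_(i in [set i | B i%:R]) [set w | tau w = Some i]) `|`
  (if pselect (B 0) then ~` (\bigcup_i [set w | tau w = Some i]) else set0)).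
  apply: measurableU.
    by apply: bigcup_measurable => i _; exact: measurable_stopping.
  by case: (pselect (B 0)) => B0 /=; [exact: measurableC|exact: measurable0].
apply/seteqP; split => w; rewrite /rtime /=.
  case tw : (tau w) => [m|] /= Bm; first by left; exists m.
  by right; case: (pselect (B 0)) => B0 //= -[m _ /=]; rewrite tw.
move=> [[m Bm /= ->//]|]; case: (pselect (B 0)) => B0 //= nw.
case tw : (tau w) => [m|] //=; by case: nw; exists m.
Qed.

(** Both moments of a random time [m] have this form, with [c i = 1] and with
    [c i = 2 * i%:R + 1]; the sum over [i < m] is exchanged with the integral. *)
Lemma mean_alive (S : nat -> set T) (c : nat -> R) (f : T -> R) :
  (forall i, measurable (S i)) -> (forall i, 0 <= c i) ->
  measurable_fun setT f -> (forall w, 0 <= f w) ->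
  {ae P, forall w, exists2 m, (forall i, S i w <-> (i < m)%N) &
     f w = \sum_(i < m) c i} ->
  (\int[P]_w (f w)%:E = \sum_(0 <= i <oo) (c i)%:E * P (S i))%E.
Proof.
move=> mS c0 mf f0 fE.
have m1 i : measurable_fun setT (fun w => (c i * \1_(S i) w)%:E).
  apply/measurable_EFinP; apply: measurable_funM => //; exact: measurable_indic.
have s0 i w : (0 <= (c i * \1_(S i) w)%:E)%E by rewrite lee_fin mulr_ge0// indicE.
transitivity (\int[P]_w \sum_(0 <= i <oo) (c i * \1_(S i) w)%:E)%E.
  apply: ge0_ae_eq_integral => //.
  - exact/measurable_EFinP.
  - by apply: ge0_emeasurable_sum => // i w _ _.
  - by move=> w _; rewrite lee_fin.
  - by move=> w _; apply: nneseries_ge0 => i _ _.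
  move: fE; apply: filterS => w [m Sm fw] _.
  rewrite (nneseries_split 0 m)// add0n eseries0 ?adde0; last first.
    move=> i mi _; rewrite indicE (_ : w \in S i = false) ?mulr0//.
    by apply/negbTE; rewrite notin_setE => /Sm; rewrite ltnNge mi.
  rewrite fw big_mkord sumEFin; congr (_%:E); apply: eq_bigr => i _.
  by rewrite indicE mem_set ?mulr1//; apply/Sm.
rewrite integral_nneseries//; apply: eq_eseriesr => i _.
under eq_integral do rewrite EFinM.
rewrite ge0_integralZl ?lee_fin//; last by apply/measurable_EFinP/measurable_indic.
by rewrite integral_indic ?setIT.
Qed.

End Times.

(** * Null events *)

Section NullEvents.
Context {R : realType} {d : measure_display} {T : measurableType d}.
Variables (P : probability T R) (X : nat -> {RV P >-> R}).
Hypothesis X_indep : mutually_independent P (fun i => X i).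
Hypothesis X_unif : forall i, uniform01 (X i).
Local Notation F := (nat_filtration (fun i => X i : T -> R)).
Local Notation mu := (@lebesgue_measure R).

Lemma ge0_integral_eq0_ae (f : T -> R) : measurable_fun setT f -> (forall w, 0 <= f w) ->
  (\int[P]_w (f w)%:E = 0)%E -> {ae P, forall w, f w = 0}.
Proof.
move=> mf f0 If.
have mf' : measurable_fun setT (fun w => (f w)%:E) by exact/measurable_EFinP.
have /(ae_eq_integral_abs P measurableT mf') : (\int[P]_w `|(f w)%:E| = 0)%E.
  rewrite -If; apply: eq_integral => w _; by rewrite gee0_abs ?lee_fin.
by apply: filterS => w /(_ I) [].
Qed.

Lemma measurable_fun_boolr {d'} {E : measurableType d'} (p : E -> bool) :
  measurable_fun setT p -> measurable_fun setT (fun x => (p x)%:R : R).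
Proof.
move=> mp; rewrite (_ : (fun x => _) = (fun x => if p x then 1 else 0)).
  exact: measurable_fun_ifT.
by apply/funext => x; case: (p x).
Qed.

Lemma integral01_point (a : R) :
  (\int[mu]_(x in `[0%R, 1%R]) ((x == a)%:R)%:E = 0)%E.
Proof.
transitivity (\int[mu]_(x in `[0%R, 1%R]) (\1_[set a] x)%:E)%E.
  apply: eq_integral => x _; rewrite indicE; congr ((nat_of_bool _)%:R)%:E.
  by apply/eqP/idP; rewrite inE.
rewrite integral_indic; [|exact: measurable_itv|exact: (measurable_set1 a)].
have ma : measurable ([set a] : set R) := measurable_set1 a.
have m01 : measurable (`[0, 1]%classic : set R) by exact: measurable_itv.
apply/eqP; rewrite eq_le measure_ge0 andbT.
rewrite -(lebesgue_measure_set1 a); apply: le_measure; rewrite ?inE.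
- exact: (measurableI _ _ ma m01).
- exact: ma.
- by move=> x [].
Qed.

Lemma obs_in01 : {ae P, forall w, forall i, 0 <= X i w < 1}.
Proof.
apply/ae_foralln => i.
pose f (x : R) : R := (~~ (0 <= x < 1))%:R.
have mb : measurable_fun setT (fun x : R => ~~ (0 <= x < 1)).
  apply: measurable_neg; apply: measurable_and.
    exact: measurable_fun_ler.
  exact: measurable_fun_ltr.
have mf : measurable_fun setT f.
  exact: measurable_fun_boolr.
have f0 x : 0 <= f x by [].
have := @ge0_integral_eq0_ae (f \o X i) _ _ _.
have mfX : measurable_fun setT (f \o X i) by exact: measurableT_comp.
move=> /(_ mfX (fun w => f0 (X i w))).
have -> : (\int[P]_w ((f \o X i) w)%:E = 0)%E.
  rewrite (integral_obs X_unif i (f := fun x => (f x)%:E)) => [||x]; last 2 first.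
  - exact/measurable_EFinP.
  - by rewrite lee_fin.
  rewrite -(integral01_point 1); apply: eq_integral => x.
  rewrite inE/= in_itv/= /f => /andP[x0 x1]; congr ((nat_of_bool _)%:R)%:E.
  by rewrite x0/= -leNgt eq_le x1.
move=> /(_ erefl); apply: filterS => w /= /eqP.
by rewrite /f; case: (0 <= X i w < 1) => //=; rewrite oner_eq0.
Qed.

Lemma obs_distinct : {ae P, forall w, forall i j, (j < i)%N -> X i w <> X j w}.
Proof.
apply/ae_foralln => i; apply/ae_foralln => j.
have [ji|ij] := ltnP j i; last by apply: aeW => w; rewrite ?ltnNge ?ij.
pose g (y x : R) : R := (x == y)%:R.
have mb : measurable_fun setT (fun p : R * R => p.2 == p.1).
  by apply: measurable_fun_eqr; [exact: measurable_snd|exact: measurable_fst].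
have mg : measurable_fun setT (fun p : R * R => g p.1 p.2).
  exact: measurable_fun_boolr.
have mgX : measurable_fun setT (fun w => g (X j w) (X i w)).
  have mp : measurable_fun setT (fun w => (X j w, X i w)) by exact: measurable_fun_pair.
  exact: (measurableT_comp mg mp).
have := @ge0_integral_eq0_ae _ mgX (fun w => ler0n _ _).
rewrite (integral_freeze X_indep X_unif (Z := X j : T -> R) (i := i)
  (g := fun y x => (g y x)%:E)); last 3 first.
- by move=> B mB; exact: filtrationX.
- exact/measurable_EFinP.
- by move=> y x; rewrite lee_fin.
under eq_integral do rewrite integral01_point.
rewrite integral0 => /(_ erefl); apply: filterS => w + _ Xij.
by rewrite /g Xij eqxx => /eqP; rewrite oner_eq0.
Qed.

Lemma edge_null n (D : nat -> T -> bool) :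
  (forall i, F i.+1 [set w | D i w]) ->
  {ae P, forall w, forall i, X i w <> edge (remaining n D i w) (level X D i w)}.
Proof.
move=> DA; apply/ae_foralln => i.
pose g (r : nat) (y x : R) : R := (x == edge r y)%:R.
have mg r : measurable_fun setT (fun p : R * R => g r p.1 p.2).
  have m1 : measurable_fun setT (fun p : R * R => p.1) by exact: measurable_fst.
  have m2 : measurable_fun setT (fun p : R * R => p.2) by exact: measurable_snd.
  apply: measurable_fun_boolr; apply: measurable_fun_eqr => //.
  by apply: measurable_funD => //; apply: measurable_funM => //; exact: measurable_funB.
have mgX : measurable_fun setT (fun w => g (remaining n D i w) (level X D i w) (X i w)).
  exact: (measurable_next n DA i mg).
have := @ge0_integral_eq0_ae _ mgX (fun w => ler0n _ _).
rewrite (@integral_next _ _ _ P X X_indep X_unif n D DA i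
  (fun r y x => (g r y x)%:E)); last 2 first.
- by move=> r; apply/measurable_EFinP.
- by move=> r y x; rewrite lee_fin.
under eq_integral do rewrite integral01_point.
rewrite integral0 => /(_ erefl); apply: filterS => w + Xe.
by rewrite /g Xe eqxx => /eqP; rewrite oner_eq0.
Qed.

End NullEvents.

(** * Lower bound and uniqueness *)

Section Policies.
Context {R : realType} {d : measure_display} {T : measurableType d}.
Variables (P : probability T R) (X : nat -> {RV P >-> R}).
Hypothesis X_indep : mutually_independent P (fun i => X i).
Hypothesis X_unif : forall i, uniform01 (X i).
Variables (n : nat) (n1 : (1 <= n)%N) (tau : nat -> T -> option nat).
Hypothesis tauP : selection_policy P (fun i => X i) n tau.

Local Notation F := (nat_filtration (fun i => X i : T -> R)).
Local Notation b := (@optv R).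

Definition policy_decide (i : nat) (w : T) : bool := hits n (tau ^~ w) i.

Local Notation D := policy_decide.
Local Notation alive := (alive n D).

Lemma policy_decide_adapted i : F i.+1 [set w | D i w].
Proof.
have [st _] := tauP.
rewrite (_ : mkset _ = \bigcup_k (if (k < n)%N then [set w | tau k.+1 w = Some i.+1] else set0)).
  have [_ _ h] := filtration_salgebra X i.+1; apply: h => k.
  case: ifP => kn; last exact: filtration0.
  by apply: stopping_adapted; exact: st.
apply/seteqP; split => w /=.
  by move=> /existsP[[k kn] /eqP /= tk]; exists k => //=; rewrite kn.
move=> [k _]; case: ifP => // kn /= tk.
by apply/existsP; exists (Ordinal kn); rewrite /= tk.
Qed.

(** By [run_hits], the times given by the policy and the numbers of selections
    given by its decisions carry the same information. *)
Lemma policy_path : {ae P, forall w, valid_path X n D w /\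
  exists s : nat -> nat, [/\ forall k, (1 <= k <= n)%N -> tau k w = Some (s k),
    forall i, (selected D i w <= n)%N &
    forall i k, (1 <= k <= n)%N -> (s k <= i)%N = (k <= selected D i w)%N]}.
Proof.
have [_ path] := tauP; have X01 := obs_in01 X_unif.
apply: filterS2 X01 path => w X01 [s [ts s1 sS so]].
have inv := run_hits ts s1 sS.
split; last first.
  by exists s; split => // i; have [] := inv i.
move=> i; split; first exact: X01.
move=> Di.
have [c1n c1 _] := inv i.+1; have [cn c lE] := inv i.
rewrite -/(selected D i w) in cn c lE.
have cS : (run (hits n (tau ^~ w)) i.+1).1 = (selected D i w).+1.
  by rewrite -[LHS]/(selected D i.+1 w) selectedS Di.
rewrite cS in c1n c1.
have sc : s (selected D i w).+1 = i.+1.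
  apply/eqP; rewrite eqn_leq c1 ?c1n//= leqnn andTb ltnNge c ?c1n//.
  by rewrite ltnn.
split; first by rewrite /remaining subn_gt0.
rewrite /level -[run (D ^~ w) i]/(run (hits n (tau ^~ w)) i) lE.
case E : (selected D i w) => [|l]; first by have /andP[] := X01 i.
rewrite E in sc c1n; have := so l.+1; rewrite c1n sc => /(_ isT) /ltW.
by [].
Qed.

Lemma mean_time_series : measurable_fun setT (rtime (tau n) : T -> R) /\
  ('E_P[rtime (tau n)] = \sum_(0 <= i <oo) P (alive i))%E.
Proof.
have [st _] := tauP.
have mt : measurable_fun setT (rtime (tau n) : T -> R).
  by apply: measurable_rtime; apply: st; rewrite n1 leqnn.
split => //; rewrite unlock.
rewrite (@mean_alive _ _ _ P alive (fun=> 1))//.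
- by apply: eq_eseriesr => i _; rewrite mul1e.
- by move=> i; exact: (measurable_alive n policy_decide_adapted i).
- have := policy_path; apply: filterS => w [_ [s [ts cn sc]]].
  exists (s n) => [i|]; last by rewrite /rtime ts ?n1 ?leqnn// sumr_const card_ord.
  by rewrite /alive /= /remaining subn_gt0 ltnNge -sc ?n1 ?leqnn// -ltnNge.
Qed.

(** The tails of an integrable time are summable, so they vanish in the limit. *)
Lemma alive_summable : ('E_P[rtime (tau n)] < +oo)%E ->
  (fun i => fine (P (alive i))) @ \oo --> (0 : R).
Proof.
have [_ ->] := mean_time_series => fin.
have p0 i : (0 <= P (alive i))%E by [].
have pf i : P (alive i) \is a fin_num.
  by apply: fin_num_measure; exact: (measurable_alive n policy_decide_adapted i).
apply: (@cvg0_le_tail _ _ (fine (\sum_(0 <= i <oo) P (alive i))%E)) => [i|N].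
  exact: fine_ge0.
rewrite -lee_fin fineK; last first.
  by rewrite ge0_fin_numE// nneseries_ge0.
rewrite -sumEFin; under eq_bigr do rewrite fineK//.
by rewrite -(big_mkord xpredT (fun i => P (alive i))); exact: nneseries_lim_ge.
Qed.

Lemma policy_gap_le (C : R) N : b n <= C -> ('E_P[rtime (tau n)] < +oo)%E ->
  ((b n)%:E + \sum_(i < N) \int[P]_w (gap X n D (trunc C) i w)%:E <=
   C%:E * P (alive N) + 'E_P[rtime (tau n)])%E.
Proof.
move=> bC fin; have C0 : 0 <= C by apply: le_trans bC; exact: optv_ge0.
have vp : {ae P, forall w, valid_path X n D w}.
  by have := policy_path; apply: filterS => w [].
have := lower_bound_gap X_indep X_unif policy_decide_adapted
  (trunc_value_function C0) (trunc_subsolution C0) vp N.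
have -> : trunc C n 0 = b n.
  by rewrite truncE ?ltr01// inv1E ?ltr01// subr0 invr1 mulr1.
move=> /le_trans; apply; rewrite leeD2l//.
have [_ ->] := mean_time_series.
by rewrite -(big_mkord xpredT (fun i => P (alive i))); exact: nneseries_lim_ge.
Qed.

Lemma cvg_alive_bound (C : R) (e : \bar R) (K : nat) : ('E_P[rtime (tau n)] < +oo)%E ->
  (forall N, (K <= N)%N -> (e <= C%:E * P (alive N) + 'E_P[rtime (tau n)])%E) ->
  (e <= 'E_P[rtime (tau n)])%E.
Proof.
move=> fin eC; have cp := alive_summable fin.
have pf i : P (alive i) = (fine (P (alive i)))%:E.
  by rewrite fineK// fin_num_measure//; exact: (measurable_alive n policy_decide_adapted i).
have ef : ('E_P[rtime (tau n)] = (fine 'E_P[rtime (tau n)])%:E)%E.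
  rewrite fineK// ge0_fin_numE//; have [_ ->] := mean_time_series.
  by rewrite nneseries_ge0.
apply/lee_addgt0Pr => eps eps0.
have e' : 0 < eps / (`|C| + 1) by rewrite divr_gt0// ltr_pwDr.
have /cvgrPdist_lt /(_ _ e') [M _ /(_ (maxn M K) (leq_maxl M K))] := cp.
set N := maxn M K; have KN : (K <= N)%N by rewrite leq_maxr.
rewrite /= sub0r normrN ger0_norm ?fine_ge0// => pN.
apply: le_trans (eC N KN) _; rewrite addeC leeD2l// pf -EFinM lee_fin.
apply: (@le_trans _ _ (`|C| * fine (P (alive N)))).
  by rewrite ler_wpM2r ?fine_ge0// ler_norm.
apply: (@le_trans _ _ ((`|C| + 1) * (eps / (`|C| + 1)))); last first.
  by rewrite mulrC divfK// gt_eqF// ltr_pwDr.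
by apply: ler_pM => //; [exact: fine_ge0|rewrite lerDl|exact: ltW].
Qed.

(** Truncating at [b n] does not change the value of the initial state, and the
    remainder [b n * P (alive N)] vanishes as [N] goes to infinity. *)
Lemma policy_lower_bound : ('E_P[rtime (tau n)] < +oo)%E ->
  ((b n)%:E <= 'E_P[rtime (tau n)])%E.
Proof.
move=> fin; apply: (@cvg_alive_bound (b n) _ 0) => // N _.
have := @policy_gap_le (b n) N (lexx _) fin.
apply: le_trans; rewrite leeDl// sume_ge0// => i _.
by apply: integral_ge0 => w _; rewrite lee_fin gap_ge0.
Qed.

Hypothesis tau_opt : ('E_P[rtime (tau n)] = (b n)%:E)%E.

(** The lower bound being attained, nothing is left for the gaps, whatever the
    level [C] of the truncation. *)
Lemma gap_eq0 (C : R) i : b n <= C ->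
  {ae P, forall w, gap X n D (trunc C) i w = 0}.
Proof.
move=> bC; have C0 : 0 <= C by apply: le_trans bC; exact: optv_ge0.
have fin : ('E_P[rtime (tau n)] < +oo)%E by rewrite tau_opt ltry.
have I0 j : (0 <= \int[P]_w (gap X n D (trunc C) j w)%:E)%E.
  by apply: integral_ge0 => w _; rewrite lee_fin gap_ge0.
apply: ge0_integral_eq0_ae.
- apply: measurable_gap; first exact: policy_decide_adapted.
  exact: (trunc_value_function C0).
- by move=> w; exact: gap_ge0.
apply/eqP; rewrite eq_le I0 andbT.
suff : ((b n)%:E + \int[P]_w (gap X n D (trunc C) i w)%:E <= (b n)%:E)%E.
  by rewrite -leeBrDl// subee.
rewrite -[leRHS]tau_opt; apply: (@cvg_alive_bound C _ i.+1) => // N iN.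
apply: le_trans (@policy_gap_le C N bC fin); rewrite leeD2l//.
by rewrite (bigD1 (Ordinal iN))//= leeDl// sume_ge0.
Qed.

Lemma gain_eq0 (h : nat -> R -> R) r y x : y <= x -> gain h r.+1 y x = 0 ->
  h r.+1 y <= h r x.
Proof.
by rewrite /gain => ->; rewrite -subr_le0 => <-; rewrite le_max lexx orbT.
Qed.

(** Where no gap occurs, the observations below the edge are selected and those
    above it are not. To hit the edge has probability zero. *)
Lemma optimal_decisions : {ae P, forall w, forall i, D i w = (0 < remaining n D i w)%N &&
  (X i w \in `[level X D i w, edge (remaining n D i w) (level X D i w)])}.
Proof.
have gap0 : {ae P, forall w, forall m i, gap X n D (trunc (b n + m%:R)) i w = 0}.
  by apply/ae_foralln => m; apply/ae_foralln => i; apply: gap_eq0; rewrite lerDl.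
have Hpath : {ae P, forall w, valid_path X n D w}.
  by have := policy_path; apply: filterS => w [].
have Hedge := edge_null X_indep X_unif n policy_decide_adapted.
apply: filterS3 gap0 Hpath Hedge => w gap0 vw Hedge i.
have X01 j : 0 <= X j w < 1 by have [] := vw j.
have /andP[l0 l1] := level01 D i X01; have /andP[x0 x1] := X01 i.
set y := level X D i w in l0 l1 *; set x := X i w in x0 x1 *.
have key r : remaining n D i w = r.+1 -> forall C, (exists m, C = b n + m%:R) ->
    b r.+1 * inv1 y <= C ->
    b r.+1 * inv1 y = (if D i w then trunc C r x else b r.+1 * inv1 y) +
      gain (trunc C) r.+1 y x.
  move=> rE _ [m ->] VC; have := gapE (trunc (b n + m%:R)) i vw.
  rewrite gap0 addr0 rE -/y -/x truncE// remainingS levelS rE => VE.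
  by rewrite [LHS]VE; case: (D i w) => //; rewrite truncE.
case Er : (remaining n D i w) => [|r] /=.
  by case Di : (D i w) => //; have [_ /(_ Di) []] := vw i; rewrite Er.
have {}key := key r Er.
set V := b r.+1 * inv1 y in key.
have V0 : 0 < V by rewrite mulr_gt0 ?optv_gt0// inv1E// invr_gt0 subr_gt0.
(* A truncation level above the value of the current state. *)
have [m Vm] : exists m : nat, V < b n + m%:R.
  exists (Num.truncn V).+1; apply: lt_le_trans (truncnS_gt V) _.
  by rewrite -[leLHS]add0r lerD2r optv_ge0.
have {key} := key (b n + m%:R) (ex_intro _ m erefl) (ltW Vm).
rewrite in_itv/= le_edge// -/V.
(* Selected: [x] is below the edge, as selecting it does not increase the value. *)
case Di : (D i w) => VE.
  have [_ /(_ Di) [_ yx]] := vw i; rewrite yx/=; apply/esym.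
  have := gain_ge0 (trunc (b n + m%:R)) r.+1 y x => g0.
  have : trunc (b n + m%:R) r x <= V by lra.
  case: r {Er VE g0} V V0 Vm => [|r] V V0 Vm; first by rewrite optv0 mul0r ltW.
  by rewrite /= x1 ge_min leNgt Vm.
(* Not selected: there was nothing to gain, so [x] is above the edge or on it. *)
have gE : gain (trunc (b n + m%:R)) r.+1 y x = 0 by lra.
apply/esym/negbTE/negP => /andP[yx VV'].
have {gE} : V <= trunc (b n + m%:R) r x.
  by have := gain_eq0 yx gE; rewrite truncE// ltW.
case: r @V V0 Vm VV' Er VE => [|r] V V0 Vm VV' Er VE; first by rewrite leNgt V0.
rewrite /= x1 le_min => /andP[_ VV''].
have {VV' VV''} VV : b r.+1 * inv1 x = b r.+2 * inv1 y by apply/le_anti; rewrite VV'.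
apply: (Hedge i); rewrite Er -/x -/y.
have := edgeE r.+1 y; have b2 := @optv_gt0 R r.+1.
move: VV; rewrite !inv1E// => VV.
have : b r.+2 * (1 - x) = b r.+1 * (1 - y).
  have -> : b r.+2 * (1 - x) = b r.+2 / (1 - y) * ((1 - x) * (1 - y)) by field; lra.
  by rewrite -VV; field; lra.
have b20 : b r.+2 != 0 by rewrite gt_eqF.
by move=> <- /(mulfI b20); lra.
Qed.

End Policies.
Section Uniqueness.
Context {R : realType} {d : measure_display} {T : measurableType d}.
Variables (P : probability T R) (X : nat -> {RV P >-> R}).
Hypothesis X_indep : mutually_independent P (fun i => X i).
Hypothesis X_unif : forall i, uniform01 (X i).

Lemma optimal_policy_unique n (tau : nat -> T -> option nat) : (1 <= n)%N ->
  selection_policy P (fun i => X i) n tau ->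
  ('E_P[rtime (tau n)] = (optv n)%:E)%E ->
  {ae P, forall w, forall k, (1 <= k <= n)%N ->
     tau k w = threshold_time (fun i => X i : T -> R) n (@optt R) k w}.
Proof.
move=> n1 tauP tau_opt.
have dec := optimal_decisions X_indep X_unif n1 tauP tau_opt.
have path := policy_path X_unif tauP.
apply: filterS2 dec path => w dec [_ [s [ts cn sc]]] k kn.
pose D := policy_decide n tau ^~ w.
have DE i : D i = ((run D i).1 < n)%N && thr_accept X n (@optt R) w (run D i).1 (run D i).2 i.+1.
  by rewrite [LHS]dec /remaining subn_gt0.
have kn' : (k <= n)%N by case/andP: kn.
have seltimeE i := (seltime_run DE i).2 k kn'.
rewrite threshold_time_seltime ts//.
have /seltimeE [m sm ms] : (k <= (run D (s k)).1)%N by rewrite -[(run _ _).1]/(selected _ _ _) -sc.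
have : (k <= (run D m).1)%N by apply/seltimeE; exact: (ex_intro2 _ _ m sm (leqnn m)).
rewrite -[(run _ _).1]/(selected (policy_decide n tau) m w) -sc// => sm'.
by rewrite sm; congr Some; apply/eqP; rewrite eqn_leq sm' ms.
Qed.

End Uniqueness.

(** * The mean and the variance of the optimal time *)

Section OptimalPolicy.
Context {R : realType} {d : measure_display} {T : measurableType d}.
Variables (P : probability T R) (X : nat -> {RV P >-> R}).
Hypothesis X_indep : mutually_independent P (fun i => X i).
Hypothesis X_unif : forall i, uniform01 (X i).
Variables (n : nat) (n1 : (1 <= n)%N).
Local Notation F := (nat_filtration (fun i => X i : T -> R)).
Local Notation b := (@optv R).
Local Notation D := (thr_decide X n (@optt R)).
Local Notation alive := (alive n D).
Local Notation tau := (threshold_time (fun i => X i : T -> R) n (@optt R)).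

Let DA := @thr_decide_adapted _ _ _ P X n (@optt R).

Lemma opt_seltime w i : (selected D i w <= n)%N /\ forall k, (k <= n)%N ->
  (k <= selected D i w)%N <-> exists2 m, tau k w = Some m & (m <= i)%N.
Proof.
have [cn c] := seltime_run (greedyE n (thr_accept X n (@optt R) w)) i.
by split => // k kn; rewrite threshold_time_seltime; exact: c.
Qed.

Lemma opt_stopping k : (k <= n)%N -> stopping_time F (tau k).
Proof.
move=> kn i.
rewrite (_ : mkset _ = \bigcup_(j in [set j | (k <= j)%N]) [set w | selected D i w = j]).
  rewrite bigcup_mkcond; have [_ _ h] := filtration_salgebra X i; apply: h => j.
  by case: ifP => _; [exact: selected_adapted|exact: filtration0].
apply/seteqP; split => w /=.
  by move=> /((opt_seltime w i).2 k kn) kc; exists (selected D i w).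
by move=> [j /= kj cj]; apply/((opt_seltime w i).2 k kn); rewrite cj.
Qed.

(** The mean remaining time of the optimal policy. *)
Definition value (r : nat) (y : R) : R := b r * inv1 y.
(** The sum of the means of [value] at the current and at all the later times,
    from which the second moment is obtained by [tail_sums]. *)
Definition value2 (r : nat) (y : R) : R := vsum r * b r * inv1 y ^+ 2.

Lemma vsum0 : @vsum R 0 = 0.
Proof. by rewrite /vsum big_ord0. Qed.

Lemma vsumS r : @vsum R r.+1 = vsum r + b r.+1 / (b r.+1 - b r).
Proof. by rewrite /vsum big_ord_recr. Qed.

Lemma vsum_ge0 r : 0 <= @vsum R r.
Proof.
by apply: sumr_ge0 => i _; rewrite divr_ge0 ?optv_ge0// subr_ge0 ltW ?optv_lt.
Qed.

Lemma vsum_le r : (r <= n)%N -> @vsum R r <= vsum n.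
Proof.
move=> /subnK <-; elim: (n - r)%N => [//|k IHk]; rewrite addSn vsumS.
by apply: le_trans IHk _; rewrite lerDl divr_ge0 ?optv_ge0// subr_ge0 ltW ?optv_lt.
Qed.

Lemma measurable_value r : measurable_fun setT (value r).
Proof. by apply: measurable_funM => //; exact: measurable_inv1. Qed.

Lemma measurable_value2 r : measurable_fun setT (value2 r).
Proof.
apply: measurable_funM => //; apply: measurable_funX; exact: measurable_inv1.
Qed.

Lemma value_ge0 r y : 0 <= value r y.
Proof. by rewrite mulr_ge0 ?optv_ge0 ?inv1_ge0. Qed.

Lemma value2_ge0 r y : 0 <= value2 r y.
Proof. by rewrite mulr_ge0 ?exprn_ge0 ?mulr_ge0 ?vsum_ge0 ?optv_ge0 ?inv1_ge0. Qed.

Lemma stateval_alive i : stateval X n D (fun r _ => (0 < r)%N%:R) i = P (alive i).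
Proof.
rewrite /stateval.
transitivity (\int[P]_w (\1_(alive i) w)%:E)%E.
  apply: eq_integral => w _; rewrite indicE; congr ((nat_of_bool _)%:R)%:E.
  by apply/idP/idP; rewrite inE.
by rewrite integral_indic ?setIT//; exact: (measurable_alive n DA).
Qed.

Lemma value_step i : (stateval X n D value i = stateval X n D value i.+1 + P (alive i))%E.
Proof.
rewrite -stateval_alive.
apply: (stateval_next X_indep X_unif (obs_in01 X_unif)) => //.
- exact: measurable_value.
- exact: value_ge0.
- by move=> y; rewrite /value optv0 mul0r.
move=> r y y01; rewrite integral_window1// -EFinD; congr (_%:E).
have := @optv_rec R r; have := @optv_optt R r.
rewrite /value inv1E; last by case/andP: y01.
move=> <- h; have y1 : 1 - y != 0 by move: y01 => /andP[_ y1]; lra.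
have -> : @optt R r.+1 * (1 - y) * (b r.+1 / (1 - y)) = b r.+1 * optt r.+1 by field.
by rewrite /=; lra.
Qed.

Lemma value2_step i :
  (stateval X n D value2 i = stateval X n D value2 i.+1 + stateval X n D value i)%E.
Proof.
apply: (stateval_next X_indep X_unif (obs_in01 X_unif)) => //.
- exact: measurable_value2.
- exact: measurable_value.
- exact: value2_ge0.
- exact: value_ge0.
- by move=> y; rewrite /value2 optv0 mulr0 mul0r.
- by move=> y; rewrite /value optv0 mul0r.
move=> r y y01; rewrite integral_window2 ?vsum_ge0// -EFinD; congr (_%:E).
have bl : b r.+1 - b r != 0 by rewrite subr_eq0 gt_eqF ?optv_lt.
have := @optv_optt R r => bt.
have -> : vsum r * (b r.+1 - b r) * inv1 y *+ (0 < r)%N = vsum r * (b r.+1 - b r) * inv1 y.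
  by case: r {bl bt} => [|r] //; rewrite vsum0 !mul0r.
rewrite /value2 /value inv1E; last by case/andP: y01.
have y1 : 1 - y != 0 by move: y01 => /andP[_ y1]; lra.
have -> : @optt R r.+1 * (1 - y) * (vsum r.+1 * b r.+1 * (1 - y)^-1 ^+ 2) =
   (b r.+1 - b r) * vsum r.+1 / (1 - y) by rewrite -bt; field.
by rewrite vsumS; field; rewrite y1 bl.
Qed.

Lemma value0 : stateval X n D value 0 = (b n)%:E.
Proof.
rewrite /stateval.
transitivity (\int[P]_w (b n)%:E)%E.
  apply: eq_integral => w _; congr (_%:E).
  by rewrite /remaining /level /selected /= subn0 /value inv1E ?ltr01// subr0 invr1 mulr1.
by rewrite integral_cst// -[RHS]mule1; congr (_ * _)%E; exact: probability_setT.
Qed.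

Lemma value20 : stateval X n D value2 0 = (vsum n * b n)%:E.
Proof.
rewrite /stateval.
transitivity (\int[P]_w (vsum n * b n)%:E)%E.
  apply: eq_integral => w _; congr (_%:E).
  by rewrite /remaining /level /selected /= subn0 /value2 inv1E ?ltr01// subr0 invr1 expr1n mulr1.
by rewrite integral_cst// -[RHS]mule1; congr (_ * _)%E; exact: probability_setT.
Qed.

Lemma stateval_le (h : nat -> R -> R) (C : R) i :
  (forall r, measurable_fun setT (h r)) -> (forall r y, 0 <= h r y) ->
  (forall y, h 0%N y = 0) -> 0 <= C ->
  (forall w, (forall j, 0 <= X j w < 1) -> h (remaining n D i w) (level X D i w) <= C) ->
  (stateval X n D h i <= C%:E * P (alive i))%E.
Proof.
move=> mh h0 hz C0 hC.
have mA := measurable_alive n DA i.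
rewrite -stateval_alive /stateval -ge0_integralZl//; last first.
  apply/measurable_EFinP.
  by apply: (measurable_state n DA i (h := fun r _ => (0 < r)%N%:R : R)) => r; exact: measurable_cst.
apply: ae_ge0_le_integral => //.
- by move=> w _; rewrite lee_fin.
- by apply/measurable_EFinP; exact: (measurable_state n DA i).
- by move=> w _; rewrite mule_ge0// lee_fin.
- apply: measurable_funeM; apply/measurable_EFinP.
  by apply: (measurable_state n DA i (h := fun r _ => (0 < r)%N%:R : R)) => r; exact: measurable_cst.
have := obs_in01 X_unif; apply: filterS => w X01 _.
rewrite -EFinM lee_fin; have := hC w X01; case: (remaining n D i w) => [|r].
  by rewrite hz mulr0.
by rewrite mulr1.
Qed.

Lemma value_le i : (stateval X n D value i <= (b n)%:E * P (alive i))%E.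
Proof.
apply: stateval_le.
- exact: measurable_value.
- exact: value_ge0.
- by move=> y; rewrite /value optv0 mul0r.
- exact: optv_ge0.
- by move=> w X01; exact: opt_value_le.
Qed.

Lemma value2_le i :
  (stateval X n D value2 i <= (vsum n * b n ^+ 2)%:E * P (alive i))%E.
Proof.
apply: stateval_le.
- exact: measurable_value2.
- exact: value2_ge0.
- by move=> y; rewrite /value2 optv0 mulr0 mul0r.
- by rewrite mulr_ge0 ?vsum_ge0 ?exprn_ge0 ?optv_ge0.
move=> w X01; have := opt_value_le n i X01.
have : (remaining n D i w <= n)%N by rewrite leq_subr.
case: (remaining n D i w) => [|r] rn.
  by rewrite /value2 optv0 mulr0 mul0r mulr_ge0 ?vsum_ge0 ?exprn_ge0 ?optv_ge0.
set y := level X D i w => vb.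
rewrite /value2 -mulrA; apply: ler_pM; rewrite ?vsum_ge0 ?vsum_le//.
  by rewrite mulr_ge0 ?optv_ge0// exprn_ge0 ?inv1_ge0.
apply: (@le_trans _ _ ((b r.+1 * inv1 y) ^+ 2)).
  rewrite exprMn ler_wpM2r ?exprn_ge0 ?inv1_ge0//.
  by rewrite expr2 ler_peMr ?optv_ge0 ?optv_ge1.
by rewrite lerXn2r ?nnegrE ?optv_ge0// mulr_ge0 ?optv_ge0 ?inv1_ge0.
Qed.

End OptimalPolicy.

Section OptimalTime.
Context {R : realType} {d : measure_display} {T : measurableType d}.
Variables (P : probability T R) (X : nat -> {RV P >-> R}).
Hypothesis X_indep : mutually_independent P (fun i => X i).
Hypothesis X_unif : forall i, uniform01 (X i).
Variables (n : nat) (n1 : (1 <= n)%N).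
Local Notation F := (nat_filtration (fun i => X i : T -> R)).
Local Notation b := (@optv R).
Local Notation D := (thr_decide X n (@optt R)).
Local Notation alive := (alive n D).
Local Notation tau := (threshold_time (fun i => X i : T -> R) n (@optt R)).

Let DA := @thr_decide_adapted _ _ _ P X n (@optt R).

Lemma opt_tails : [/\ (fun i => fine (P (alive i))) @ \oo --> (0 : R),
  (\sum_(0 <= i <oo) P (alive i) = (b n)%:E)%E &
  (\sum_(0 <= i <oo) (2 * i%:R + 1)%:E * P (alive i) =
     (2 * (vsum n * b n) - b n)%:E)%E].
Proof.
have mA i := measurable_alive n DA i.
have pE i : P (alive i) = (fine (P (alive i)))%:E by rewrite fineK// fin_num_measure.
have st0 h i : (forall r y, 0 <= h r y) -> (0 <= stateval X n D h i)%E.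
  by move=> h0; apply: integral_ge0 => w _; rewrite lee_fin.
have fin h C i : (forall r y, 0 <= h r y) -> (stateval X n D h i <= C%:E * P (alive i))%E ->
    stateval X n D h i \is a fin_num.
  move=> h0 hC; rewrite ge0_fin_numE ?st0//.
  by apply: le_lt_trans hC _; rewrite pE -EFinM ltry.
have v_le := value_le X_unif n; have g_le := value2_le X_unif n.
have vfin i := fin _ _ _ (@value_ge0 R) (v_le i).
have gfin i := fin _ _ _ (@value2_ge0 R) (g_le i).
pose p i := fine (P (alive i)).
pose v i := fine (stateval X n D (@value R) i).
pose g i := fine (stateval X n D (@value2 R) i).
have [] := @tail_sums R p v g (b n) (vsum n * b n ^+ 2).
- by move=> i; rewrite fine_ge0.
- by move=> i; rewrite fine_ge0// st0//; exact: value_ge0.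
- by move=> i; rewrite fine_ge0// st0//; exact: value2_ge0.
- move=> i; rewrite /v (value_step X_indep X_unif n i) fineD ?vfin//.
  by rewrite pE.
- by move=> i; rewrite /g (value2_step X_indep X_unif n i) fineD ?vfin ?gfin.
- by move=> i; rewrite -lee_fin /v fineK ?vfin// EFinM -pE v_le.
- by move=> i; rewrite -lee_fin /g fineK ?gfin// EFinM -pE g_le.
move=> cp sp sg; split => //.
- rewrite -[RHS](value0 X n) -(fineK (vfin 0%N)) -[fine _]/(v 0%N) -sp.
  by apply: eq_eseriesr => i _; rewrite pE.
- transitivity (2 * g 0%N - v 0%N)%:E.
    by rewrite -sg; apply: eq_eseriesr => i _; rewrite pE EFinM.
  by rewrite /g /v value0 value20.
Qed.

Lemma opt_reaches : {ae P, forall w, exists i, remaining n D i w = 0%N}.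
Proof.
have mA i := measurable_alive n DA i.
exists (\bigcap_i alive i); split.
- exact: bigcapT_measurable.
- have [cp _ _] := opt_tails.
  apply/eqP; rewrite eq_le measure_ge0 andbT.
  have capf : P (\bigcap_i alive i) \is a fin_num.
    by rewrite fin_num_measure//; exact: bigcapT_measurable.
  rewrite -(fineK capf) lee_fin.
  apply: (@ler_cvg_to _ _ _ _ (fun=> fine (P (\bigcap_i alive i))) _ _ _ _ cp).
    exact: cvg_cst.
  near=> i; rewrite fine_le// ?fin_num_measure// le_measure ?inE//.
    exact: bigcapT_measurable.
  exact: bigcap_inf.
- move=> w /= nw i _; rewrite /alive /= lt0n; apply/eqP => ri.
  by apply: nw; exists i.
Unshelve. all: by end_near. Qed.

(** Ties between observations, which a closed interval of acceptance would
    select, are excluded by [obs_distinct]. *)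
Lemma opt_path : {ae P, forall w, exists s : nat -> nat,
  [/\ forall k, (1 <= k <= n)%N -> tau k w = Some (s k),
      (1 <= s 1)%N,
      forall k, (1 <= k < n)%N -> (s k < s k.+1)%N,
      forall k, (1 <= k < n)%N -> obs (fun i => X i : T -> R) (s k) w <
                                  obs (fun i => X i : T -> R) (s k.+1) w &
      forall i, alive i w <-> (i < s n)%N]}.
Proof.
have X01 := obs_in01 X_unif; have Xd := obs_distinct X_indep X_unif.
apply: filterS3 X01 Xd opt_reaches => w X01 Xd [i ri].
have [cn c] := opt_seltime X n w i.
have ci : selected D i w = n.
  by apply/eqP; rewrite eqn_leq cn -subn_eq0 -[(n - _)%N]/(remaining n D i w) ri.
have [s ts] : exists s : nat -> nat, forall k, (k <= n)%N -> tau k w = Some (s k).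
  exists (fun k => odflt 0%N (tau k w)) => k kn.
  have /(c k kn) [m tm _] : (k <= selected D i w)%N by rewrite ci.
  by rewrite tm.
have step k : (k < n)%N -> (s k < s k.+1)%N /\ thr_accept X n (@optt R) w k (s k) (s k.+1).
  move=> kn; have := ts _ kn; rewrite threshold_time_seltime => /seltimeS[m [+ km acc]].
  rewrite -(threshold_time_seltime X n (@optt R) k w) (ts k (ltnW kn)) => -[Em].
  by rewrite Em.
exists s; split.
- by move=> k /andP[_]; exact: ts.
- by have [+ _] := step 0%N n1; exact: leq_ltn_trans.
- by move=> k /andP[_] /step[].
- move=> k /andP[k1 kn]; have [sk] := step k kn.
  rewrite /thr_accept in_itv/= => /andP[le_obs _].
  rewrite lt_neqAle le_obs andbT; apply/eqP.
  have sk0 : (0 < s k)%N.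
    case: k k1 kn {sk le_obs} => // k _ kn.
    by have [+ _] := step k (ltnW kn); move: (s k) (s k.+1) => l [].
  case: (s k) sk0 sk => // j _; case: (s k.+1) => // j'; rewrite ltnS => jj' /=.
  by move=> /esym; exact: Xd.
- move=> j; rewrite /alive /= subn_gt0 ltnNge.
  have [cnj cj] := opt_seltime X n w j.
  split => [/negP nc|js].
    rewrite ltnNge; apply/negP => sj; apply: nc; apply/(cj n (leqnn n)).
    exact: (ex_intro2 _ _ (s n) (ts n (leqnn n)) sj).
  apply/negP => /(cj n (leqnn n)) [m]; rewrite ts// => -[<-].
  by rewrite leqNgt js.
Qed.

Lemma opt_selection_policy : selection_policy P (fun i => X i) n tau.
Proof.
split => [k /andP[_ kn]|]; first exact: opt_stopping.
by have := opt_path; apply: filterS => w [s [h1 h2 h3 h4 _]]; exists s.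
Qed.

Lemma measurable_opt_time : measurable_fun setT (rtime (tau n) : T -> R).
Proof. by apply: measurable_rtime; exact: opt_stopping. Qed.

Lemma mean_opt_time : ('E_P[rtime (tau n)] = (b n)%:E)%E.
Proof.
rewrite unlock (@mean_alive _ _ _ P alive (fun=> 1)) ?ler01//.
- have [_ <- _] := opt_tails.
  by apply: eq_eseriesr => i _; rewrite mul1e.
- exact: (measurable_alive n DA).
- exact: measurable_opt_time.
- have := opt_path; apply: filterS => w [s [ts _ _ _ sa]].
  exists (s n) => //; by rewrite /rtime ts ?n1 ?leqnn// sumr_const card_ord.
Qed.

Lemma second_moment_opt_time :
  ('E_P[(rtime (tau n) : T -> R) * (rtime (tau n) : T -> R)] =
    (2 * (vsum n * b n) - b n)%:E)%E.
Proof.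
rewrite unlock (@mean_alive _ _ _ P alive (fun i => 2 * i%:R + 1)).
- by have [_ _ <-] := opt_tails.
- exact: (measurable_alive n DA).
- by move=> i; rewrite addr_ge0// mulr_ge0.
- by apply: measurable_funM; exact: measurable_opt_time.
- by move=> w; rewrite mulr_ge0.
- have := opt_path; apply: filterS => w [s [ts _ _ _ sa]].
  exists (s n) => //; rewrite -[LHS]/((rtime (tau n) w : R) * rtime (tau n) w).
  rewrite /rtime ts ?n1 ?leqnn//=.
  elim: (s n) => [|m IHm]; first by rewrite big_ord0 mulr0.
  by rewrite big_ord_recr/= -IHm -natr1; ring.
Qed.

Lemma variance_opt_time :
  ('V_P[rtime (tau n)] = (b n * (2 * vsum n - 1 - b n))%:E)%E.
Proof.
have mt := measurable_opt_time.
have t0 w : 0 <= (rtime (tau n) : T -> R) w by [].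
have int1 : (rtime (tau n) : T -> R) \in Lfun P 1.
  apply/Lfun1_integrable; apply/integrableP; split; first exact/measurable_EFinP.
  rewrite (_ : (\int[P]_x _)%E = 'E_P[rtime (tau n)]%E); first by rewrite mean_opt_time ltry.
  by rewrite unlock; apply: eq_integral => w _; rewrite /= ger0_norm.
have int2 : (rtime (tau n) : T -> R) * (rtime (tau n) : T -> R) \in Lfun P 1.
  apply/Lfun1_integrable; apply/integrableP; split.
    by apply/measurable_EFinP; exact: measurable_funM.
  rewrite (_ : (\int[P]_x _)%E =
    'E_P[(rtime (tau n) : T -> R) * (rtime (tau n) : T -> R)]%E).
    by rewrite second_moment_opt_time ltry.
  by rewrite unlock; apply: eq_integral => w _; rewrite /= ger0_norm// mulr_ge0.
rewrite /variance covarianceE// second_moment_opt_time mean_opt_time.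
by rewrite -EFinM -EFinB; congr (_%:E); ring.
Qed.

Lemma opt_policies : policies P (fun i => X i) n tau.
Proof.
by split; [exact: opt_selection_policy|rewrite mean_opt_time ltry].
Qed.

Lemma beta_optv : beta P (fun i => X i) n = (b n)%:E.
Proof.
apply/eqP; rewrite eq_le; apply/andP; split.
  by apply: ereal_inf_lbound; exists tau; [exact: opt_policies|exact: mean_opt_time].
apply: le_ereal_inf_tmp => _ [t [tP fin] <-].
exact: (policy_lower_bound X_indep X_unif n1 tP fin).
Qed.

Lemma opt_optimal : optimal_threshold_policy P (fun i => X i) n tau.
Proof.
split; last by rewrite beta_optv mean_opt_time.
split; first exact: opt_policies.
exists (@optt R) => // -[//|i] _; first by rewrite ltW ?optt_gt0// optt_le1.
Qed.

End OptimalTime.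

Theorem theorem2 (R : realType) (d : measure_display) (T : measurableType d)
    (P : probability T R) (X : nat -> {RV P >-> R})
    (X_indep : mutually_independent P (fun i => X i))
    (X_unif : forall i, uniform01 (X i)) :
  exists tau_star : nat -> nat -> T -> option nat,
    (forall n : nat, (1 <= n)%N ->
       optimal_threshold_policy P (fun i => X i) n (tau_star n) /\
       (forall tau, optimal_threshold_policy P (fun i => X i) n tau ->
          same_policy P n tau (tau_star n))) /\
    (\forall n \near \oo, 'V_P[rtime (tau_star n n)]%E \is a fin_num) /\
    (forall alpha : R, 2 < alpha ->
       (fun n : nat => fine 'V_P[rtime (tau_star n n)]%E)
         = (fun n : nat => 3^-1 * n%:R ^+ 3)
           +O_\oo (fun n : nat => n%:R ^+ 2 * ln n%:R `^ alpha)).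
Proof.
exists (fun n => threshold_time (fun i => X i : T -> R) n (@optt R)).
split; [|split].
- move=> n n1; split; first exact: opt_optimal.
  move=> tau [[[tauP fin] _] tau_opt]; apply: optimal_policy_unique => //.
  by rewrite tau_opt beta_optv.
- exists 1%N => // n /= n1.
  by rewrite variance_opt_time.
- move=> alpha alpha2.
  have bound m : (3 <= m)%N ->
    `|fine 'V_P[rtime (threshold_time (fun i => X i : T -> R) m (@optt R) m)]%E
      - 3^-1 * m%:R ^+ 3| <= 300 * `|m%:R ^+ 2 * ln m%:R `^ alpha|.
    move=> m3; rewrite variance_opt_time//; last exact: leq_trans m3.
    case: m m3 => [|[|[|m]]] // _; have [l1 _ _ _] := @optv_asymptotics R m.
    apply: le_trans (variance_asymptotics m) _.
    rewrite ler_wpM2l// ger0_norm; last by rewrite mulr_ge0 ?exprn_ge0 ?powR_ge0.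
    rewrite ler_wpM2l// -[leLHS]powRr1; last lra.
    by rewrite ler_powR//; lra.
  apply/eqaddOP/bigO_exP; exists 300; first by rewrite ltr0n.
  by exists 3%N => // m m3; exact: bound.
Qed.
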